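(* Let $q>0$, $\sigma>\frac{1433}{1248}$, $s>1$, and let $\theta$ be a $(q,K,\sigma)$-Diophantine 2D rotation for some $K>0$. Let $j\in\{1,2\}$ and let $f\in L^1(\Gamma_{\mathcal M})$ be such that the Fourier coefficients of $|\nabla|^{2(\sigma+s)}f$ are bounded, i.e. $\sup_{G\in\mathcal R_{\mathcal M}^*}|G|^{2(\sigma+s)}|\hat f(G)|<\infty$. Then for all $N\in\mathbb N$ large enough $$\Big|\frac1{(2N+1)^2}\sum_{R_j\in\mathcal R_j(N)}f(\{R_j\}_{\mathcal M})-\frac1{|\Gamma_{\mathcal M}|}\int_{\Gamma_{\mathcal M}}f(x)\,dx\Big|\le\frac{2\sqrt2}{K}\Big(\frac{\rho_{\mathcal M}\|A\|_2}{2\pi}\Big)^{2(\sigma+s)}\big(\zeta(2s)+2^{-s}\zeta(s)^2\big)\sup_{G\in\mathcal R^*_{\mathcal M}}|G|^{2(\sigma+s)}|\hat f(G)|\;\frac1{2N+1}.$$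
   Context: Let $q>0$, $\theta\in\mathbb R$, $A\in GL_2(\mathbb R)$, and let $R_\phi$ be rotation of $\mathbb R^2$ by $\phi$. Set $A_1=q^{-1/2}R_{-\theta/2}A$, $A_2=q^{1/2}R_{\theta/2}A$, $\mathcal R_j=A_j\mathbb Z^2$, $\mathcal R_j(N)=A_j\{-N,\dots,N\}^2$, $\mathcal R_j^*=2\pi A_j^{-T}\mathbb Z^2$. Standing assumptions: $\mathcal R_1^*\cap\mathcal R_2^*=\{0\}$ and $\mathcal R_1\cap\mathcal R_2=\{0\}$. Moiré lattice: $A_{\mathcal M}=(A_1^{-1}-A_2^{-1})^{-1}$, $\mathcal R_{\mathcal M}=A_{\mathcal M}\mathbb Z^2$, $\Gamma_{\mathcal M}=A_{\mathcal M}[0,1)^2$, $\mathcal R^*_{\mathcal M}=2\pi A_{\mathcal M}^{-T}\mathbb Z^2$. For $x\in\mathbb R^2$, $\{x\}_{\mathcal M}$ is the unique element of $\Gamma_{\mathcal M}$ with $x-\{x\}_{\mathcal M}\in\mathcal R_{\mathcal M}$. Given $q>0$, $\theta$ is a $(q,K,\sigma)$-Diophantine 2D rotation ($K,\sigma>0$) if for all $n\in\mathbb Z^2\setminus\{0\}$ $$\operatorname{dist}\big(q^{\pm1}A^TR_{\pm\theta}A^{-T}n,\mathbb Z^2\big)\ge \frac{K}{|n|^{2\sigma}},$$ i.e. both $\operatorname{dist}(qA^TR_{\theta}A^{-T}n,\mathbb Z^2)\ge K|n|^{-2\sigma}$ and $\operatorname{dist}(q^{-1}A^TR_{-\theta}A^{-T}n,\mathbb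 Z^2)\ge K|n|^{-2\sigma}$. $\hat f(G)=\frac1{|\Gamma_{\mathcal M}|}\int_{\Gamma_{\mathcal M}}e^{-iG\cdot x}f(x)\,dx$ for $G\in\mathcal R_{\mathcal M}^*$; $\|A\|_2$ is the spectral norm; $\zeta$ is the Riemann zeta function; $\rho_{\mathcal M}=[(q^{1/2}-q^{-1/2})^2+4\sin^2(\theta/2)]^{-1/2}$ is the moiré length scale ratio.
   Formalization: The Diophantine condition is assumed for all four independent sign choices in q^{±1}, R_{±θ}, not only the two matched ones: with matched signs alone the bound fails for some A when q≠1, since layers 1 and 2 are governed by (q^{-1},θ) and (q,−θ). *)

(* Defs.v *)
From HB Require Import structures.
From mathcomp Require Import all_boot all_order all_algebra.
From mathcomp Require Import all_classical all_reals all_analysis.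
From mathcomp Require Import complex.
Set Implicit Arguments.
Unset Strict Implicit.
Unset Printing Implicit Defensive.
Import Order.TTheory GRing.Theory Num.Theory.
Import numFieldNormedType.Exports.
Local Open Scope classical_set_scope.
Local Open Scope ring_scope.

Section Plane.
Context {R : realType}.

Definition dotv (x y : 'cV[R]_2) : R := \sum_i x i 0 * y i 0.

(* Euclidean norm; the library norm of a matrix is the max norm. *)
Definition enorm (x : 'cV[R]_2) : R := Num.sqrt (dotv x x).

Definition spectral_norm (M : 'M[R]_2) : R :=
  sup [set enorm (M *m x) | x in [set x | enorm x <= 1]].

Definition rotation (phi : R) : 'M[R]_2 :=
  \matrix_(i, j) if i == j then cos phi
                 else if i == 0 then - sin phi else sin phi.

Definition lattice (M : 'M[R]_2) : set 'cV[R]_2 :=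
  [set M *m map_mx intr n | n in [set: 'cV[int]_2]].

Definition lattice_box (M : 'M[R]_2) (N : nat) : set 'cV[R]_2 :=
  [set M *m map_mx intr n | n in
    [set n : 'cV[int]_2 | forall i, `|n i 0| <= N%:Z]].

Definition dual_lattice (M : 'M[R]_2) : set 'cV[R]_2 :=
  [set (2 * pi) *: x | x in lattice (invmx M)^T].

Definition unit_cell (M : 'M[R]_2) : set 'cV[R]_2 :=
  [set M *m t | t in [set t : 'cV[R]_2 | forall i, 0 <= t i 0 < 1]].

(* The representative of x modulo [lattice M] in [unit_cell M]; it exists and
   is unique when M is invertible. *)
Definition cell_mod (M : 'M[R]_2) (x : 'cV[R]_2) : 'cV[R]_2 :=
  xget 0 [set y | unit_cell M y /\ lattice M (x - y)].

Definition dist_Z2 (x : 'cV[R]_2) : R :=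
  inf [set enorm (x - z) | z in lattice 1%:M].

Definition zeta (t : R) : R := limn (series (riemannR t)).

End Plane.

Section Integration.
Context {R : realType}.

(* Lebesgue measure lives on R * R; [pt] carries it to column vectors. *)
Definition pt (u : R * R) : 'cV[R]_2 := \col_i if i == 0 then u.1 else u.2.

Local Notation lebesgue2 :=
  (@lebesgue_measure R \x @lebesgue_measure R)%E.

Definition area (D : set 'cV[R]_2) : R := fine (lebesgue2 (pt @^-1` D)).

Definition cintegrable (D : set 'cV[R]_2) (f : 'cV[R]_2 -> R[i]) : Prop :=
  lebesgue2.-integrable (pt @^-1` D) (fun u => (complex.Re (f (pt u)))%:E) /\
  lebesgue2.-integrable (pt @^-1` D) (fun u => (complex.Im (f (pt u)))%:E).

Definition cintegral (D : set 'cV[R]_2) (f : 'cV[R]_2 -> R[i]) : R[i] :=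
  Complex (Rintegral lebesgue2 (pt @^-1` D) (fun u => complex.Re (f (pt u))))
          (Rintegral lebesgue2 (pt @^-1` D) (fun u => complex.Im (f (pt u)))).

Definition cmean (D : set 'cV[R]_2) (f : 'cV[R]_2 -> R[i]) : R[i] :=
  (real_complex R (area D))^-1 * cintegral D f.

Definition expi (t : R) : R[i] := Complex (cos t) (sin t).

Definition fourier_coef (M : 'M[R]_2) (f : 'cV[R]_2 -> R[i])
    (G : 'cV[R]_2) : R[i] :=
  cmean (unit_cell M) (fun x => expi (- dotv G x) * f x).

(* An L^1 function is only defined almost everywhere, so its values at lattice
   points are those of its continuous representative on the torus R^2/lattice. *)
Definition continuous_representative (M : 'M[R]_2)
    (f g : 'cV[R]_2 -> R[i]) : Prop :=
  [/\ continuous (fun x => complex.Re (g x)),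
      continuous (fun x => complex.Im (g x)),
      (forall x y, lattice M y -> g (x + y) = g x) &
      {ae lebesgue2, forall u, unit_cell M (pt u) -> f (pt u) = g (pt u)}].

Definition fourier_weights (M : 'M[R]_2) (a : R)
    (f : 'cV[R]_2 -> R[i]) : set R :=
  [set enorm G `^ a * complex.Re `|fourier_coef M f G| | G in dual_lattice M].

End Integration.

Section Moire.
Context {R : realType}.
Implicit Types (A : 'M[R]_2) (q theta : R).

Inductive layer := layer1 | layer2.

Definition layer_mx A q theta (j : layer) : 'M[R]_2 :=
  match j with
  | layer1 => q `^ (- 2^-1) *: (rotation (- (theta / 2)) *m A)
  | layer2 => q `^ (2^-1) *: (rotation (theta / 2) *m A)
  end.

Definition moire_mx A q theta : 'M[R]_2 :=
  invmx (invmx (layer_mx A q theta layer1) - invmx (layer_mx A q theta layer2)).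

Definition moire_ratio q theta : R :=
  ((q `^ (2^-1) - q `^ (- 2^-1)) ^+ 2 + 4 * sin (theta / 2) ^+ 2) `^ (- 2^-1).

Definition incommensurate A q theta : Prop :=
  dual_lattice (layer_mx A q theta layer1) `&`
    dual_lattice (layer_mx A q theta layer2) = [set 0] /\
  lattice (layer_mx A q theta layer1) `&`
    lattice (layer_mx A q theta layer2) = [set 0].

Definition diophantine_bound A (Q phi K sigma : R) : Prop :=
  forall n : 'cV[int]_2, n != 0 ->
    K / enorm (map_mx intr n) `^ (2 * sigma) <=
    dist_Z2 (Q *: (A^T *m rotation phi *m (invmx A)^T *m map_mx intr n)).

(* The signs in q^{+-1} and R_{+-theta} vary independently.  The phases at the
   points of layers 1 and 2 are governed by
     A_1^T A_2^{-T} = q^{-1} A^T R_theta A^{-T}  and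
     A_2^T A_1^{-T} = q A^T R_{-theta} A^{-T},
   so bounds for the matched signs (q, theta), (q^{-1}, -theta) alone do not
   control them. *)
Definition diophantine_rotation A q (K sigma theta : R) : Prop :=
  [/\ diophantine_bound A q theta K sigma,
      diophantine_bound A q^-1 (- theta) K sigma,
      diophantine_bound A q^-1 theta K sigma &
      diophantine_bound A q (- theta) K sigma].

End Moire.

(* Main.v *)
(** Each wave e^(iG.x), with G = 2 pi A_M^(-T) m and m <> 0, restricted to layer
    j is n |-> e^(2 pi i y.n) with y congruent to +-A_j^T A_k^(-T) m modulo Z^2,
    k being the other layer; its sum over the box is a product of two Dirichlet
    kernels, each at most 2N+1 and one of them at most 1/(2d) with
    d >= K |m|^(-2 sigma) / sqrt 2.  Since |m| <= rho ||A|| |G| / (2 pi), summing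
    against the Fourier coefficients leaves the lattice sum of |m|^(-2s), which is
    at most 4 (zeta(2s) + 2^(-s) zeta(s)^2): the axes give the first term and AM-GM
    off the axes the second.

    This needs f to be the sum of its absolutely convergent Fourier series, for
    which it suffices that an integrable h with zero Fourier coefficients vanishes
    almost everywhere.  The bounded functions w such that, for bounded v, h v w has
    zero coefficients whenever h v has form an algebra closed under bounded
    pointwise limits, so the sets whose indicator is such a w form a sigma-algebra.
    It contains the sets {cos(2 pi t - pi b) >= cos(pi b)}, which trace {t <= b} on
    the cell in each lattice coordinate t, hence all Borel sets, and so h
    integrates to 0 on each of them. *)
Require Import Defs.
From HB Require Import structures.
From mathcomp Require Import all_boot all_order all_algebra.
From mathcomp Require Import all_classical all_reals all_analysis.
From mathcomp Require Import measurable_realfun complex ring lra zify.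
Set Implicit Arguments.
Unset Strict Implicit.
Unset Printing Implicit Defensive.
Import Order.TTheory GRing.Theory Num.Theory.
Import numFieldNormedType.Exports.
Local Open Scope classical_set_scope.
Local Open Scope ring_scope.

(** Since f is only L^1, nothing a priori ties its values at lattice points to its coefficients; the
    uniqueness theorem is what identifies the sum of the series with f almost everywhere. The decay
    is spent twice: with exponent 2(sigma+s) > 2 to make the coefficients summable, and with the
    exponent 2s > 2 that remains after the small divisors have cost |m|^(2 sigma). Uniqueness goes
    through bounded pointwise limits rather than uniform approximation, so that dominated
    convergence and the product-to-sum formula suffice. All integrals are real: real and imaginary
    parts are separate series in cosines and sines, and the waves cos(2 pi phase + p) with arbitrary
    p form a family in which a product of two members is an average of two members. The estimate is
    proved for every partial sum of the series with a bound independent of its length; for fixed N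
    the box is finite, so the limit needs no interchange of infinite sums. The constant 2 sqrt 2 / K
    is the 4 of the lattice sum times the sqrt 2 / (2 K) of one Dirichlet kernel. *)

(** * Bernoulli's inequality and two consequences *)

Section BernoulliInequality.
Context {R : rcfType}.
Implicit Types (x y : R) (m n : nat).

Lemma bernoulli_onem y m : 0 <= y <= 1 -> 1 - m%:R * y <= (1 - y) ^+ m.
Proof.
move=> /andP[y0 y1]; elim: m => [|m IH]; first by rewrite expr0; lra.
have my : 0 <= m%:R * y by rewrite mulr_ge0.
rewrite exprS -natr1; have : 0 <= (1 - y) * ((1 - y) ^+ m - (1 - m%:R * y)).
  by apply: mulr_ge0; lra.
have : 0 <= m%:R * y * y by rewrite mulr_ge0.
nra.
Qed.

Lemma bernoulli x m : 0 <= x -> 1 + m%:R * x <= (1 + x) ^+ m.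
Proof.
move=> x0; elim: m => [|m IH]; first by rewrite expr0; lra.
have mx : 0 <= m%:R * x by rewrite mulr_ge0.
rewrite exprS -natr1; have : 0 <= (1 + x) * ((1 + x) ^+ m - (1 + m%:R * x)).
  by apply: mulr_ge0; lra.
have : 0 <= m%:R * x * x by rewrite mulr_ge0.
nra.
Qed.

(** (1 - y)^m (1 + y)^m = (1 - y^2)^m is at most 1, and Bernoulli bounds (1 + y)^m from below. *)
Lemma bernoulli_onem_ub y m : 0 <= y <= 1 -> (1 - y) ^+ m * (1 + m%:R * y) <= 1.
Proof.
move=> /andP[y0 y1].
have h : (1 - y) ^+ m * (1 + y) ^+ m <= 1.
  by rewrite -exprMn exprn_ile1//; nra.
apply: le_trans h; rewrite ler_wpM2l ?bernoulli// exprn_ge0//; lra.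
Qed.

(** Bernoulli for x itself gives only linear growth; applied to sqrt x and squared it gives
    quadratic growth, which beats the numerator and leaves a harmonic bound. *)
Lemma natr_div_exp_le x n : 1 < x -> n.+1%:R / x ^+ n.+1 <=
  (Num.sqrt x - 1) ^- 2 * n.+1%:R^-1.
Proof.
move=> x1; set s := Num.sqrt x.
have x0 : 0 <= x by lra.
have s1 : 1 < s by rewrite -sqrtr1 ltr_sqrt//; lra.
rewrite -[in x ^+ _](sqr_sqrtr x0) -/s -exprM mulnC exprM.
have b : n.+1%:R * (s - 1) <= s ^+ n.+1.
  have := @bernoulli (s - 1) n.+1; rewrite [1 + (s - 1)]addrC subrK; lra.
have d0 : 0 < n.+1%:R * (s - 1) by rewrite mulr_gt0 ?subr_gt0.
have h : (n.+1%:R * (s - 1)) ^+ 2 <= (s ^+ n.+1) ^+ 2.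
  by rewrite lerXn2r// ?nnegrE ltW// (lt_le_trans d0).
have n0 : n.+1%:R != 0 :> R by rewrite pnatr_eq0.
have s0 : s - 1 != 0 by rewrite gt_eqF// subr_gt0.
rewrite ler_pdivrMr; last by rewrite !exprn_gt0//; lra.
rewrite [leLHS](_ : _ = (s - 1) ^- 2 * n.+1%:R^-1 * (n.+1%:R * (s - 1)) ^+ 2).
  by rewrite ler_wpM2l// mulr_ge0 ?invr_ge0// exprn_ge0// subr_ge0 ltW.
by field; rewrite s0 addrC natr1 n0.
Qed.

End BernoulliInequality.

(** * Polynomials converging to a step function *)

Section SoftThreshold.
Context {R : realType}.
Implicit Types (x : R) (n : nat).

(* On [0, 1] this tends to the indicator of [x <= 1/2]: by Bernoulli it is at
   least 1 - (2x)^n / n and at most 1 / (1 + (2x)^n / n). *)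
Definition soft_threshold n x : R := (1 - n.+1%:R^-1 * x ^+ n.+1) ^+ (2 ^ n.+1).

(** The outer exponent 2^(n+1) doubles x inside the power, which moves the threshold from 1 to
    1/2. *)
Let powE n x : (2 ^ n.+1)%:R * (n.+1%:R^-1 * x ^+ n.+1) =
  n.+1%:R^-1 * (2 * x) ^+ n.+1.
Proof. by rewrite natrX exprMn; ring. Qed.

Let base01 n x : 0 <= x <= 1 -> 0 <= n.+1%:R^-1 * x ^+ n.+1 <= 1.
Proof.
move=> /andP[x0 x1]; rewrite mulr_ge0 ?exprn_ge0//= mulr_ile1 ?exprn_ge0//.
  by rewrite invf_le1// ler1n.
exact: exprn_ile1.
Qed.

Lemma soft_threshold01 n x : 0 <= x <= 1 -> 0 <= soft_threshold n x <= 1.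
Proof.
move=> /(base01 n)/andP[y0 y1]; rewrite exprn_ge0 ?subr_ge0//=.
by rewrite exprn_ile1 ?subr_ge0 ?gerBl.
Qed.

(** The endpoint 1/2 is included thanks to the factor 1/(n+1): without it the limit there would be
    e^(-1). This is why closed level sets are obtained. *)
Lemma soft_threshold_cvg1 x : 0 <= x <= 2^-1 ->
  soft_threshold n x @[n --> \oo] --> (1 : R).
Proof.
move=> /andP[x0 x12]; have x01 : 0 <= x <= 1 by lra.
have h1 : (1 - @harmonic R n) @[n --> \oo] --> (1 : R).
  rewrite -[X in _ --> X](subr0 1).
  by apply: cvgB; [exact: cvg_cst|exact: cvg_harmonic].
apply: squeeze_cvgr h1 (cvg_cst (1 : R)).
near=> n; have /andP[_ ->] := soft_threshold01 n x01; rewrite andbT.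
apply: le_trans (bernoulli_onem _ (base01 n x01)); rewrite powE lerB//.
rewrite /harmonic/= ler_piMr// exprn_ile1//; lra.
Unshelve. all: by end_near. Qed.

Lemma soft_threshold_cvg0 x : 2^-1 < x <= 1 ->
  soft_threshold n x @[n --> \oo] --> (0 : R).
Proof.
move=> /andP[x12 x1]; have x01 : 0 <= x <= 1 by lra.
have h0 : ((Num.sqrt (2 * x) - 1) ^- 2 * @harmonic R n) @[n --> \oo] --> (0 : R).
  rewrite -[X in _ --> X](mulr0 ((Num.sqrt (2 * x) - 1) ^- 2)).
  by apply: cvgM; [exact: cvg_cst|exact: cvg_harmonic].
apply: squeeze_cvgr (cvg_cst (0 : R)) h0.
near=> n; have /andP[-> _] := soft_threshold01 n x01; rewrite /=.
have x2 : 1 < 2 * x by lra.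
apply: le_trans (natr_div_exp_le n x2).
have := bernoulli_onem_ub (2 ^ n.+1) (base01 n x01); rewrite powE -/(soft_threshold n x).
have /andP[t0 _] := soft_threshold01 n x01.
have p0 : 0 < (2 * x) ^+ n.+1 by rewrite exprn_gt0//; lra.
move=> h; rewrite -[leRHS]invrK invfM invrK -[leRHS]mul1r ler_pdivlMr ?mulr_gt0 ?invr_gt0//.
by apply: le_trans h; rewrite ler_wpM2l// lerDr.
Unshelve. all: by end_near. Qed.

End SoftThreshold.

(** * Weights preserving orthogonality, and the sigma-algebra they define *)

Section Multipliers.
Context {R : realType} d (T : measurableType d).
Variables (mu : {measure set T -> \bar R}) (D : set T) (h : T -> R).
Hypothesis mD : measurable D.
Hypothesis ih : mu.-integrable D (EFin \o h).

Definition bmeas (w : T -> R) : Prop :=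
  measurable_fun setT w /\ exists C, forall x, `|w x| <= C.

Lemma bmeas_cst c : bmeas (cst c).
Proof. by split=> //; exists `|c|. Qed.

Lemma bmeasD v w : bmeas v -> bmeas w -> bmeas (v \+ w).
Proof.
move=> [mv [B Bv]] [mw [C Cw]]; split; first exact: measurable_funD.
by exists (B + C) => x; rewrite (le_trans (ler_normD _ _))// lerD.
Qed.

Lemma bmeasM v w : bmeas v -> bmeas w -> bmeas (v \* w).
Proof.
move=> [mv [B Bv]] [mw [C Cw]]; split; first exact: measurable_funM.
by exists (B * C) => x; rewrite normrM ler_pM.
Qed.

Lemma bmeas_integrable w : bmeas w -> mu.-integrable D (EFin \o (h \* w)).
Proof.
move=> [mw [C Cw]].
have -> : EFin \o (h \* w) = ((EFin \o h) \* (EFin \o w))%E.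
  by apply/funext => x /=; rewrite EFinM.
apply: integrableMl => //; first exact: measurable_funTS.
exists C; split=> [|r Cr x _]; first exact: num_real.
exact: le_trans (Cw x) (ltW Cr).
Qed.

Definition bcvg (w : nat -> T -> R) (v : T -> R) : Prop :=
  [/\ forall n, measurable_fun setT (w n),
      exists C, forall n x, `|w n x| <= C &
      forall x, w n x @[n --> \oo] --> v x].

Lemma bcvg_bmeas w v : bcvg w v -> bmeas v.
Proof.
move=> [mw [C Cw] wv]; split.
  by apply: (measurable_fun_cvg mw) => x _; exact: wv.
exists C => x; have nwv : `|w n x| @[n --> \oo] --> `|v x| by exact: cvg_norm.
have -> : `|v x| = limn (fun n => `|w n x|) by exact/esym/cvg_lim.
by apply: limr_le; [exact: cvgP nwv|exact: nearW].
Qed.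

Lemma Rintegral_bcvg w v : bcvg w v ->
  \int[mu]_(x in D) (h x * w n x) @[n --> \oo] --> \int[mu]_(x in D) (h x * v x).
Proof.
move=> bwv; have [mw [C Cw] wv] := bwv.
have bw n : bmeas (w n) by split => //; exists C.
have mh : measurable_fun D h by exact/measurable_EFinP/(measurable_int mu).
have [|||||_ _] := @dominated_convergence _ _ _ mu D mD
    (fun n x => (h x * w n x)%:E) (fun x => (h x * v x)%:E)
    (fun x => (C%:E * `|(h x)%:E|)%E).
- move=> n; apply/measurable_EFinP/measurable_funM => //.
  exact: measurable_funTS.
- apply/measurable_EFinP/measurable_funM => //.
  by apply: measurable_funTS; have [] := bcvg_bmeas bwv.
- apply: aeW => x Dx; apply: cvg_EFin; first exact: nearW.
  by apply: cvgM; [exact: cvg_cst|exact: wv].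
- by apply: integrableZl => //; exact: integrable_abse.
- apply: aeW => x n Dx; rewrite -EFinM/= lee_fin normrM mulrC.
  by rewrite ler_wpM2r.
rewrite -[X in _ --> X]fineK; first exact: fine_cvg.
exact/integrable_fin_num/bmeas_integrable/(bcvg_bmeas bwv).
Qed.

Variables (I : Type) (e : I -> T -> R).

Definition orthogonal_to (w : T -> R) :=
  forall i, \int[mu]_(x in D) (h x * (w x * e i x)) = 0.

(** Quantifying over all weights [v], and not only over [v = 1], makes closure under products
    immediate. *)
Definition multiplier (w : T -> R) : Prop :=
  bmeas w /\ forall v, bmeas v -> orthogonal_to v -> orthogonal_to (v \* w).

Hypothesis be : forall i, bmeas (e i).

Lemma multiplier_cst c : multiplier (cst c).
Proof.
split; first exact: bmeas_cst.
move=> v bv ov i.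
rewrite (_ : (fun x => _) = fun x => c * (h x * (v x * e i x))); last first.
  by apply/funext => x /=; ring.
rewrite RintegralZl ?ov ?mulr0//.
exact: (bmeas_integrable (bmeasM bv (be i))).
Qed.

Lemma multiplierD v w : multiplier v -> multiplier w -> multiplier (v \+ w).
Proof.
move=> [bv ov] [bw ow]; split; first exact: bmeasD.
move=> u bu ou i.
rewrite (_ : (fun x => _) = fun x =>
  h x * ((u x * v x) * e i x) + h x * ((u x * w x) * e i x)); last first.
  by apply/funext => x /=; ring.
rewrite RintegralD ?(ov u)// ?(ow u)// ?addr0//.
- exact: (bmeas_integrable (bmeasM (bmeasM bu bv) (be i))).
- exact: (bmeas_integrable (bmeasM (bmeasM bu bw) (be i))).
Qed.

Lemma multiplierM v w : multiplier v -> multiplier w -> multiplier (v \* w).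
Proof.
move=> [bv ov] [bw ow]; split; first exact: bmeasM.
move=> u bu ou i.
rewrite (_ : (fun x => _) = fun x => h x * (((u \* v) \* w) x * e i x)).
  by apply: ow; [exact: bmeasM|exact: ov].
by apply/funext => x /=; ring.
Qed.

Lemma multiplierX v n : multiplier v -> multiplier (fun x => v x ^+ n).
Proof.
move=> mv; elim: n => [|n IH].
  by under eq_fun do rewrite expr0; exact: multiplier_cst.
by under eq_fun do rewrite exprS; exact: multiplierM.
Qed.

(** By dominated convergence the integral for [v] is a limit of integrals that all vanish. *)
Lemma multiplier_cvg w v : bcvg w v -> (forall n, multiplier (w n)) ->
  multiplier v.
Proof.
move=> bwv mw; have [mwn [C Cw] wv] := bwv.
have bv := bcvg_bmeas bwv; split => // u bu ou i.
have [mu_ [B Bu]] := bu; have [mei [E Ee]] := be i.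
have uw : bcvg (fun n x => u x * w n x * e i x) (fun x => u x * v x * e i x).
  split.
  - by move=> n; apply: measurable_funM => //; exact: measurable_funM.
  - by exists (B * C * E) => n x; rewrite !normrM !ler_pM// mulr_ge0.
  - move=> x; apply: cvgM; last exact: cvg_cst.
    by apply: cvgM; [exact: cvg_cst|exact: wv].
have := Rintegral_bcvg uw.
rewrite (_ : (fun n => _) = cst 0); last first.
  by apply/funext => n; have [_ ow] := mw n; rewrite (ow u).
by move=> /(cvg_unique (@norm_hausdorff _ _)) => /(_ _ (cvg_cst _)).
Qed.

Lemma multiplier_eq_on v w : bmeas w -> {in D, v =1 w} ->
  multiplier v -> multiplier w.
Proof.
move=> bw vw [bv ov]; split => // u bu ou i.
rewrite -(ov u bu ou i); apply: eq_Rintegral => x xD /=.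
by rewrite vw.
Qed.

Lemma sigma_algebra_multiplier :
  sigma_algebra setT [set E | multiplier (\1_E)].
Proof.
split.
- by rewrite /= (_ : \1_set0 = cst 0); [exact: multiplier_cst|exact: indic0].
- move=> A /= mA.
  rewrite (_ : \1__ = cst 1 \+ (cst (-1) \* \1_A)).
    by apply: multiplierD; [|apply: multiplierM] => //; exact: multiplier_cst.
  apply/funext => x /=; rewrite !indicE setTD in_setC.
  by case: (x \in A) => /=; ring.
- move=> F /= mF.
  (* [w n] is the indicator of the complement of the first n sets. It is a finite product of
     multipliers and converges boundedly to the indicator of the complement of the union; one more
     complement gives the union. *)
  pose w n x : R := \prod_(i < n) (1 - \1_(F i) x).
  have mw n : multiplier (w n).
    elim: n => [|n IH].
      rewrite (_ : w 0%N = cst 1); first exact: multiplier_cst.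
      by apply/funext => x; rewrite /w big_ord0.
    rewrite (_ : w n.+1 = w n \* (cst 1 \+ (cst (-1) \* \1_(F n)))).
      apply: multiplierM => //; apply: multiplierD; first exact: multiplier_cst.
      by apply: multiplierM => //; exact: multiplier_cst.
    apply/funext => x; rewrite /w big_ord_recr/=; congr (_ * _); ring.
  have w01 n x : 0 <= w n x <= 1.
    rewrite /w; elim/big_ind : _ => [|a b|i _]; first by rewrite ler01 lexx.
      move=> /andP[a0 a1] /andP[b0 b1]; rewrite mulr_ge0//=.
      by rewrite (le_trans (ler_pM a0 b0 a1 b1))// mulr1.
    by rewrite indicE; case: (_ \in _); rewrite /= ?subrr ?subr0 ?lexx ?ler01.
  have : multiplier (cst 1 \+ (cst (-1) \* \1_(\bigcup_k F k))).
    apply: (@multiplier_cvg w) => //; split.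
    + by move=> n; have [[]] := mw n.
    + by exists 1 => n x; have /andP[? ?] := w01 n x; rewrite ger0_norm.
    + move=> x; rewrite /= indicE.
      have [|xF] := boolP (x \in \bigcup_k F k).
        rewrite inE => -[k _ Fkx]; rewrite mulr1 subrr.
        apply: cvg_near_cst; exists k.+1 => // n /= kn.
        rewrite /w (bigD1 (Ordinal kn))//= indicE mem_set//=.
        by rewrite subrr mul0r.
      rewrite mulr0 addr0; apply: cvg_near_cst; apply: nearW => n.
      rewrite /w big1// => i _; rewrite indicE memNset ?subr0//= => Fix.
      by move: xF; rewrite notin_setE; apply; exists i.
  move=> mU.
  rewrite (_ : \1__ = cst 1 \+
     (cst (-1) \* (cst 1 \+ (cst (-1) \* \1_(\bigcup_k F k))))).
    apply: multiplierD; first exact: multiplier_cst.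
    by apply: multiplierM => //; exact: multiplier_cst.
  by apply/funext => x /=; ring.
Qed.

Lemma multiplier_ge v (k : R) : (forall x, `|v x| <= 1) -> -1 <= k <= 1 ->
  multiplier v -> multiplier (\1_[set x | k <= v x]).
Proof.
move=> v1 /andP[k0 k1] mv.
(* Since [v x] and [k] lie in [-1, 1], their difference is at most 2 in absolute value, so the
   factor 1/4 keeps [X x] in [0, 1]; and [X x <= 1/2] exactly when [k <= v x]. *)
pose X x := 2^-1 + 4^-1 * (k - v x).
have X01 x : 0 <= X x <= 1.
  by have := v1 x; rewrite ler_norml /X => /andP[? ?]; lra.
have mX : multiplier X.
  rewrite (_ : X = cst (2^-1 + 4^-1 * k) \+ (cst (- 4^-1) \* v)).
    apply: multiplierD; first exact: multiplier_cst.
    by apply: multiplierM => //; exact: multiplier_cst.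
  by apply/funext => x; rewrite /X /=; ring.
have mw n : multiplier (fun x => soft_threshold n (X x)).
  apply: multiplierX.
  rewrite (_ : (fun x => _) =
      cst 1 \+ (cst (- n.+1%:R^-1) \* (fun x => X x ^+ n.+1))).
    apply: multiplierD; first exact: multiplier_cst.
    by apply: multiplierM; [exact: multiplier_cst|exact: multiplierX].
  by apply/funext => x /=; rewrite mulNr.
apply: multiplier_cvg (mw); split.
- by move=> n; have [[]] := mw n.
- exists 1 => n x; have /andP[? ?] := soft_threshold01 n (X01 x).
  by rewrite ger0_norm.
- move=> x; rewrite indicE; have /andP[X0 X1] := X01 x.
  have [kv|kv] := leP k (v x).
    rewrite mem_set//=; apply: soft_threshold_cvg1; rewrite X0 /X; lra.
  rewrite memNset/=; last by move/(lt_le_trans kv); rewrite ltxx.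
  by apply: soft_threshold_cvg0; rewrite X1 /X andbT; lra.
Qed.

Lemma multiplier_all_ae0 : orthogonal_to (cst 1) ->
  (exists i, forall x, e i x = 1) ->
  (forall E, measurable E -> multiplier (\1_E)) ->
  {ae mu, forall x, D x -> h x = 0}.
Proof.
move=> o1 [i ei1] hE.
have : ae_eq mu D (EFin \o h) (cst 0%E).
  (* It is enough that [h] integrates to 0 over every measurable subset of [D]. *)
  apply: integral_ae_eq => // E ED mE.
  have [bE oE] := hE E mE.
  have : \int[mu]_(x in D) (h x * \1_E x) = 0.
    rewrite -[RHS](oE (cst 1) (bmeas_cst 1) o1 i).
    by apply: eq_Rintegral => x _ /=; rewrite ei1 mul1r mulr1.
  (* The real integral is [fine] of the extended one and would also be 0 for an infinite value, so
     finiteness is needed to lift the equation. *)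
  move=> h0; have H : (\int[mu]_(x in D) (h x * \1_E x)%:E)%E = 0%E.
    rewrite -[0%E]/(0%:E) -h0 fineK//.
    exact: (integrable_fin_num mD (bmeas_integrable bE)).
  rewrite integral0 -[RHS]H.
  rewrite integral_mkcond [in RHS]integral_mkcond.
  apply: eq_integral => x _; rewrite /patch /= indicE.
  case: ifPn => xE; first by rewrite mem_set ?mulr1//; apply: ED; exact: set_mem.
  by case: ifPn => //=; rewrite mulr0.
apply: filterS => x hx Dx.
by have := hx Dx => /= -[].
Qed.

End Multipliers.

(** * Integer multiples of the period of sine and cosine *)

Section Periodicity.
Context {R : realType}.
Implicit Types (x : R) (k : int).

Lemma cosD2piz k x : cos (x + 2 * pi * k%:~R) = cos x.
Proof.
have pos n y : cos (y + 2 * pi * n%:R) = cos y :> R.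
  rewrite -[RHS](periodicn (@cosD2pi R) n); congr (cos (_ + _)).
  by rewrite -mulr_natr -(mulr_natr _ n); ring.
case: k => n; first exact: pos.
by rewrite NegzE -[in RHS](pos n.+1) -[x in RHS](subrK (2 * pi * n.+1%:R)) pos intrN mulrN.
Qed.

Lemma sinD2piz k x : sin (x + 2 * pi * k%:~R) = sin x.
Proof. by rewrite -!cosBpihalf -[RHS](cosD2piz k); congr cos; ring. Qed.

End Periodicity.

(** * Convergence of the zeta series *)

Section RiemannZeta.
Context {R : realType}.
Implicit Types (t : R).

Lemma riemannR_ge0 t n : 0 <= riemannR t n :> R.
Proof. by rewrite invr_ge0 powR_ge0. Qed.

Lemma nondecreasing_riemannR t : nondecreasing_seq (series (@riemannR R t)).
Proof. by apply: nondecreasing_series => n _ _; exact: riemannR_ge0. Qed.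

(** Cauchy condensation. As [riemannR t i] is (i+1)^(-t), the first 2^k - 1 terms are those of the
    integers below 2^k; the 2^k integers from 2^k on contribute at most (2^k)^(1-t). *)
Lemma riemannR_dyadic_le t k : 0 <= t ->
  series (@riemannR R t) (2 ^ k).-1 <= \sum_(i < k) (2 `^ (1 - t)) ^+ i.
Proof.
move=> t0; elim: k => [|k IH]; first by rewrite seriesEnat/= big_nil big_ord0.
have k2 : (0 < 2 ^ k)%N by rewrite expn_gt0.
have -> : (2 ^ k.+1).-1 = (2 ^ k + (2 ^ k).-1)%N.
  by rewrite expnS mul2n -addnn -subn1 -addnBA// subn1.
rewrite series_addn big_ord_recr/= lerD//.
apply: (@le_trans _ _ (\sum_((2 ^ k).-1 <= i < 2 ^ k + (2 ^ k).-1)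
    ((2 ^ k)%:R `^ t)^-1)).
  rewrite [leLHS]big_nat_cond [leRHS]big_nat_cond.
  apply: ler_sum => i /andP[/andP[ki _] _] /=.
  rewrite lef_pV2 ?posrE ?powR_gt0 ?ltr0n// ge0_ler_powR ?nnegrE//.
  by rewrite ler_nat -(prednK k2).
rewrite sumr_const_nat addnK -[X in X <= _]mulr_natl natrX.
rewrite -(powR_mulrn k (ler0n _ 2)) -(powR_mulrn k (powR_ge0 _ _)) -!powRrM.
rewrite -powRN -powRD; last by rewrite pnatr_eq0 implybT.
by rewrite le_eqVlt; apply/orP; left; apply/eqP; congr (_ `^ _); ring.
Qed.

Lemma cvg_riemannR t : 1 < t -> cvgn (series (@riemannR R t)).
Proof.
move=> t1; apply: nondecreasing_is_cvgn; first exact: nondecreasing_riemannR.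
set z : R := 2 `^ (1 - t).
have z0 : 0 <= z by exact: powR_ge0.
have z1 : z < 1.
  rewrite /z -opprB powRN invf_lt1 ?powR_gt0//.
  have : (1 : R) `^ (t - 1) < 2 `^ (t - 1).
    by apply: gt0_ltr_powR; rewrite ?nnegrE ?subr_gt0// ltr1n.
  by rewrite powR1.
exists (1 - z)^-1 => _ [n _ <-].
have n2 : (n <= (2 ^ n).-1)%N.
  by rewrite -ltnS prednK ?expn_gt0// ltn_expl.
apply: le_trans (nondecreasing_riemannR _ n2) _.
apply: le_trans (riemannR_dyadic_le _ _) _; first lra.
rewrite -/z -[leRHS]mul1r ler_pdivlMr ?subr_gt0// mulrC.
have -> : (1 - z) * \sum_(i < n) z ^+ i = 1 - z ^+ n.
  by rewrite -opprB mulNr -subrX1 opprB.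
by rewrite gerBl exprn_ge0.
Qed.

Lemma series_riemannR_le t n : 1 < t -> series (riemannR t) n <= zeta t.
Proof.
move=> t1; apply: nondecreasing_cvgn_le; first exact: nondecreasing_riemannR.
exact: cvg_riemannR.
Qed.

End RiemannZeta.

(** * The sum of |m|^(-2t) over the nonzero integer points *)

Section LatticeSum.
Context {R : realType}.
Implicit Types (t : R) (K : nat) (m : int * int).

Lemma ler_sum_uniq (T : eqType) (s s' : seq T) (F : T -> R) :
  uniq s -> uniq s' -> {subset s <= s'} -> (forall x, 0 <= F x) ->
  \sum_(x <- s) F x <= \sum_(x <- s') F x.
Proof.
move=> us us' ss' F0; rewrite [leRHS](bigID (mem s))/= -[X in X + _]big_filter.
have ps : perm_eq [seq i <- s' | i \in s] s.
  apply: uniq_perm => //; first exact: filter_uniq.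
  by move=> x; rewrite mem_filter; case: (boolP (x \in s)) => //= /ss'.
by rewrite (perm_big _ ps)/= lerDl sumr_ge0.
Qed.

(** [Negz i] is -(i+1), so the second list is one shorter and the whole runs over -K, ..., K. *)
Definition int_segment K : seq int :=
  [seq Posz i | i <- iota 0 K.+1] ++ [seq Negz i | i <- iota 0 K].

Lemma int_segment_uniq K : uniq (int_segment K).
Proof.
rewrite cat_uniq !map_inj_uniq ?iota_uniq ?andbT/=; last 2 first.
- by move=> i j [].
- by move=> i j [].
by apply/hasPn => _ /mapP[i _ ->]; apply/mapP => -[].
Qed.

Lemma mem_int_segment K (a : int) : (absz a <= K)%N -> a \in int_segment K.
Proof.
rewrite mem_cat; case: a => i iK; apply/orP.
- by left; apply/mapP; exists i; rewrite ?mem_iota.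
- by right; apply/mapP; exists i; rewrite ?mem_iota.
Qed.

Lemma sum_int_segment K (F : int -> R) : (forall a, F (- a) = F a) ->
  \sum_(a <- int_segment K) F a = F 0 + 2 * \sum_(i < K) F i.+1.
Proof.
move=> Fe; have iE n : iota 0 n = index_iota 0 n by rewrite /index_iota subn0.
rewrite big_cat !big_map !iE !big_mkord big_ord_recl/= -addrA; congr (_ + _).
rewrite mulr_natl mulr2n; congr (_ + _).
by apply: eq_bigr => i _; rewrite NegzE Fe.
Qed.

(** This is |m|^(-2t), with the square root avoided. *)
Definition lattice_weight t m : R :=
  (m.1%:~R ^+ 2 + m.2%:~R ^+ 2) `^ (- t).

Lemma lattice_weight_ge0 t m : 0 <= lattice_weight t m.
Proof. exact: powR_ge0. Qed.

Lemma lattice_weight_axis t i : (i.+1%:R ^+ 2) `^ (- t) = riemannR (2 * t) i.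
Proof.
by rewrite -(powR_mulrn 2 (ler0n _ _)) -powRrM mulrN powRN.
Qed.

Lemma lattice_weight_quadrant t i k : 0 <= t ->
  lattice_weight t (i.+1%:Z, k.+1%:Z) <=
  2 `^ (- t) * (riemannR t i * riemannR t k).
Proof.
move=> t0; rewrite /lattice_weight/= !powRN -!invfM.
have i0 : 0 < i.+1%:R :> R by rewrite ltr0n.
have k0 : 0 < k.+1%:R :> R by rewrite ltr0n.
rewrite -!powRM// ?mulr_ge0//.
rewrite lef_pV2 ?posrE ?powR_gt0 ?mulr_gt0 ?addr_gt0 ?exprn_gt0//.
rewrite ge0_ler_powR ?nnegrE ?mulr_ge0 ?addr_ge0 ?sqr_ge0//.
have := sqr_ge0 (i.+1%:R - k.+1%:R : R); nra.
Qed.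

(** By evenness in each coordinate a box splits into four half-axes, each at most zeta(2t), and four
    open quadrants, each at most 2^(-t) zeta(t)^2. *)
Lemma sum_lattice_weight_le t (s : seq (int * int)) : 1 < t -> uniq s ->
  \sum_(m <- s) lattice_weight t m <=
  4 * (zeta (2 * t) + 2 `^ (- t) * zeta t ^+ 2).
Proof.
move=> t1 us.
have [K Ks] : exists K, forall m, m \in s -> (absz m.1 <= K)%N && (absz m.2 <= K)%N.
  elim: s {us} => [|m s [K IH]]; first by exists 0%N.
  exists (maxn (maxn (absz m.1) (absz m.2)) K) => n.
  rewrite inE => /orP[/eqP->|/IH/andP[h1 h2]].
    by rewrite !leq_max !leqnn ?orbT.
  by rewrite !leq_max h1 h2 ?orbT.
pose box := [seq (a, b) | a <- int_segment K, b <- int_segment K].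
apply: (@le_trans _ _ (\sum_(m <- box) lattice_weight t m)).
  apply: ler_sum_uniq => //.
  - apply: allpairs_uniq; rewrite ?int_segment_uniq//.
    by move=> [a b] [a' b'] _ _ [-> ->].
  - move=> m /Ks/andP[h1 h2]; apply/allpairsP; exists m.
    by rewrite !mem_int_segment -?surjective_pairing.
  - exact: lattice_weight_ge0.
have we1 a b : lattice_weight t (- a, b) = lattice_weight t (a, b).
  by rewrite /lattice_weight/= intrN sqrrN.
have we2 a b : lattice_weight t (a, - b) = lattice_weight t (a, b).
  by rewrite /lattice_weight/= intrN sqrrN.
rewrite big_allpairs/=.
under eq_bigr do rewrite sum_int_segment//.
rewrite sum_int_segment; last first.
  move=> a; rewrite we1; congr (_ + 2 * _); apply: eq_bigr => i _; exact: we1.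
(* A nonzero real power of 0 is 0 by convention, so the origin drops out of the sum by itself. *)
have w00 : lattice_weight t (0, 0) = 0.
  by rewrite /lattice_weight/= expr0n addr0 powR0// oppr_eq0; lra.
have wax1 (i : nat) : lattice_weight t (0, i.+1%:Z) = riemannR (2 * t) i.
  by rewrite /lattice_weight/= expr0n add0r lattice_weight_axis.
have wax2 (i : nat) : lattice_weight t (i.+1%:Z, 0) = riemannR (2 * t) i.
  by rewrite /lattice_weight/= expr0n addr0 lattice_weight_axis.
under eq_bigr do rewrite wax1.
under [X in _ + 2 * X]eq_bigr do rewrite wax2.
rewrite w00 add0r big_split/= -mulr_sumr.
have S2 : \sum_(i < K) riemannR (2 * t) i <= zeta (2 * t).
  have := @series_riemannR_le R (2 * t) K; rewrite seriesEord/=; apply; lra.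
have S1 : \sum_(i < K) riemannR t i <= zeta t.
  by have := @series_riemannR_le R t K t1; rewrite seriesEord.
have S10 : 0 <= \sum_(i < K) riemannR t i.
  by apply: sumr_ge0 => i _; exact: riemannR_ge0.
have quad : \sum_(i < K) \sum_(k < K) lattice_weight t (i.+1%:Z, k.+1%:Z) <=
    2 `^ (- t) * zeta t ^+ 2.
  apply: (@le_trans _ _ (2 `^ (- t) * (\sum_(i < K) riemannR t i) ^+ 2)).
    rewrite expr2 mulr_suml mulr_sumr ler_sum// => i _.
    rewrite [X in _ * X]mulr_sumr mulr_sumr ler_sum// => k _.
    by apply: lattice_weight_quadrant; lra.
  by rewrite ler_wpM2l ?powR_ge0// lerXn2r// nnegrE// (le_trans S10).
lra.
Qed.

End LatticeSum.

(** * Absolutely summable families indexed by pairs of integers *)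

Section SummableFamilies.
Context {R : realType}.
Implicit Types (F B : int * int -> R) (k l : nat).

(* The first [k] codes of pairs of integers, skipping the unused ones. *)
Definition int2_enum k : seq (int * int) := pmap pickle_inv (iota 0 k).

Lemma int2_enum_uniq k : uniq (int2_enum k).
Proof. by apply: (pmap_uniq (@pickle_invK _)); exact: iota_uniq. Qed.

Lemma mem_int2_enum m k : (m \in int2_enum k) = (pickle m < k)%N.
Proof.
rewrite mem_pmap; apply/mapP/idP => [[n]|mk].
  rewrite mem_iota/= add0n => nk /esym mn.
  by have := @pickle_invK (int * int)%type n; rewrite mn /= => ->.
by exists (pickle m); rewrite ?mem_iota// pickleK_inv.
Qed.

Lemma int2_enum_cat k l : (k <= l)%N -> exists s, int2_enum l = int2_enum k ++ s.
Proof.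
by move=> kl; rewrite -(subnKC kl) /int2_enum iotaD pmap_cat; eexists.
Qed.

Definition psum F k : R := \sum_(m <- int2_enum k) F m.

Lemma psumD F G k : psum (fun m => F m + G m) k = psum F k + psum G k.
Proof. exact: big_split. Qed.

Lemma nondecreasing_psum F : (forall m, 0 <= F m) -> nondecreasing_seq (psum F).
Proof.
move=> F0 k l /int2_enum_cat[s sE].
by rewrite /psum sE big_cat/= lerDl sumr_ge0.
Qed.

(** Bounding all duplicate-free finite sums does not depend on the enumeration, and it is the form
    in which the lattice sum is estimated. *)
Definition summable2 B := (forall m, 0 <= B m) /\
  exists C, forall s : seq (int * int), uniq s -> \sum_(m <- s) B m <= C.

Lemma summable2_cvg B F : summable2 B -> (forall m, `|F m| <= B m) ->
  cvgn (psum F).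
Proof.
move=> [B0 [C BC]] FB.
have nnc G : (forall m, 0 <= G m) -> (forall m, G m <= 2 * B m) -> cvgn (psum G).
  move=> G0 GB; apply: nondecreasing_is_cvgn; first exact: nondecreasing_psum.
  exists (2 * C) => _ [k _ <-].
  apply: (@le_trans _ _ (2 * psum B k)); first by rewrite mulr_sumr ler_sum.
  by rewrite ler_pM2l//; exact/BC/int2_enum_uniq.
(* F is the difference of F + B and B, both nonnegative and at most 2B, so monotone convergence
   applies to each. *)
have -> : psum F = fun k => psum (fun m => F m + B m) k - psum B k.
  by apply/funext => k; rewrite psumD addrK.
apply: is_cvgB; apply: nnc => // m.
- by have := FB m; rewrite ler_norml; lra.
- by have := FB m; rewrite ler_norml; lra.
- by have := B0 m; lra.
Qed.

(** The right-hand side depends on the majorant alone; applied at every point it gives uniform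
    convergence of trigonometric series. *)
Lemma summable2_tail B F k : summable2 B -> (forall m, `|F m| <= B m) ->
  `|limn (psum F) - psum F k| <= limn (psum B) - psum B k.
Proof.
move=> sB FB; have cF := summable2_cvg sB FB.
have cB : cvgn (psum B).
  by apply: (summable2_cvg sB) => m; rewrite ger0_norm//; have [] := sB.
have c1 : `|psum F l - psum F k| @[l --> \oo] --> `|limn (psum F) - psum F k|.
  by apply: cvg_norm; apply: cvgB => //; exact: cvg_cst.
have c2 : psum B l - psum B k @[l --> \oo] --> limn (psum B) - psum B k.
  by apply: cvgB => //; exact: cvg_cst.
have -> : `|limn (psum F) - psum F k| = limn (fun l => `|psum F l - psum F k|).
  exact/esym/cvg_lim.
have -> : limn (psum B) - psum B k = limn (fun l => psum B l - psum B k).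
  exact/esym/cvg_lim.
apply: ler_lim; [exact: cvgP c1|exact: cvgP c2|].
near=> l; have [s sE] : exists s, int2_enum l = int2_enum k ++ s.
  by apply: int2_enum_cat; near: l; exact: nbhs_infty_ge.
have incE G : psum G l - psum G k = \sum_(m <- s) G m.
  by rewrite /psum sE big_cat/= addrAC subrr add0r.
by rewrite !incE (le_trans (ler_norm_sum _ _ _))// ler_sum.
Unshelve. all: by end_near. Qed.

Lemma summable2_tail_cvg B : summable2 B ->
  limn (psum B) - psum B k @[k --> \oo] --> (0 : R).
Proof.
move=> sB; rewrite -(subrr (limn (psum B))); apply: cvgB; first exact: cvg_cst.
by apply: (summable2_cvg sB) => m; rewrite ger0_norm//; have [] := sB.
Qed.

End SummableFamilies.

(** * The complex modulus and exponential *)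

Section Modulus.
Context {R : realType}.
Implicit Types (z w : R[i]) (t : R).

(** The norm of [R[i]] takes its values in [R[i]]; this is the same number seen in [R]. *)
Definition cmod z : R := complex.Re `|z|.

Lemma cmodE z : cmod z = Num.sqrt (complex.Re z ^+ 2 + complex.Im z ^+ 2).
Proof. by rewrite /cmod normc_def. Qed.

Lemma real_complex_cmod z : real_complex R (cmod z) = `|z|.
Proof. by rewrite /cmod normc_def. Qed.

Lemma cmod_ge0 z : 0 <= cmod z.
Proof. by rewrite cmodE sqrtr_ge0. Qed.

Lemma cmodM z w : cmod (z * w) = cmod z * cmod w.
Proof. by apply: complexI; rewrite rmorphM/= !real_complex_cmod normrM. Qed.

Lemma cmod_real t : cmod (real_complex R t) = `|t|.
Proof. by rewrite cmodE/= expr0n addr0 sqrtr_sqr. Qed.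

Lemma cmod_sum (T : Type) (s : seq T) (P : pred T) (F : T -> R[i]) :
  cmod (\sum_(i <- s | P i) F i) <= \sum_(i <- s | P i) cmod (F i).
Proof.
rewrite -lecR real_complex_cmod rmorph_sum/=.
under [leRHS]eq_bigr do rewrite real_complex_cmod.
exact: ler_norm_sum.
Qed.

Lemma cmodB_le z w : cmod (z - w) <= cmod z + cmod w.
Proof. by rewrite -lecR rmorphD/= !real_complex_cmod ler_normB. Qed.

Lemma norm_Re_le z : `|complex.Re z| <= cmod z.
Proof. by rewrite cmodE -sqrtr_sqr ler_sqrt ?lerDl ?addr_ge0 ?sqr_ge0. Qed.

Lemma norm_Im_le z : `|complex.Im z| <= cmod z.
Proof. by rewrite cmodE -sqrtr_sqr ler_sqrt ?lerDr ?addr_ge0 ?sqr_ge0. Qed.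

Lemma ReD z w : complex.Re (z + w) = complex.Re z + complex.Re w.
Proof. by case: z w => [? ?] [? ?]. Qed.

Lemma ImD z w : complex.Im (z + w) = complex.Im z + complex.Im w.
Proof. by case: z w => [? ?] [? ?]. Qed.

Lemma Re_realM t z : complex.Re (real_complex R t * z) = t * complex.Re z.
Proof. by case: z => a b /=; rewrite mul0r subr0. Qed.

Lemma Im_realM t z : complex.Im (real_complex R t * z) = t * complex.Im z.
Proof. by case: z => a b /=; rewrite mul0r addr0. Qed.

Lemma Re_sum (T : Type) (s : seq T) (P : pred T) (F : T -> R[i]) :
  complex.Re (\sum_(i <- s | P i) F i) = \sum_(i <- s | P i) complex.Re (F i).
Proof. exact: (big_morph _ ReD). Qed.

Lemma Im_sum (T : Type) (s : seq T) (P : pred T) (F : T -> R[i]) :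
  complex.Im (\sum_(i <- s | P i) F i) = \sum_(i <- s | P i) complex.Im (F i).
Proof. exact: (big_morph _ ImD). Qed.

Lemma complexP z w :
  complex.Re z = complex.Re w -> complex.Im z = complex.Im w -> z = w.
Proof. by case: z w => [? ?] [? ?] /= -> ->. Qed.

Lemma expiD (a b : R) : expi (a + b) = expi a * expi b.
Proof. by apply: complexP; rewrite /= ?cosD// sinD addrC. Qed.

Lemma expi0 : expi 0 = 1 :> R[i].
Proof. by rewrite /expi cos0 sin0. Qed.

Lemma expi_2piz t (k : int) : expi (t + 2 * pi * k%:~R) = expi t.
Proof. by rewrite /expi cosD2piz sinD2piz. Qed.

Lemma cmod_expi t : cmod (expi t) = 1.
Proof. by rewrite cmodE/= cos2Dsin2 sqrtr1. Qed.

Lemma cmod_expi_sub1 t : cmod (expi (2 * t) - 1) = 2 * `|sin t|.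
Proof.
have -> : 2 * `|sin t| = Num.sqrt ((2 * sin t) ^+ 2).
  by rewrite sqrtr_sqr normrM ger0_norm.
rewrite cmodE/= oppr0 addr0; congr Num.sqrt.
rewrite !mulr_natl sin_mulr2n cos_mulr2n.
have := cos2Dsin2 t; rewrite !mulr2n; nra.
Qed.

End Modulus.

(** * Jordan's inequality and bounds for Dirichlet kernels *)

Section DirichletKernel.
Context {R : realType}.
Implicit Types (x y d : R) (N : nat).

(* If [sin (pi x) < 2 x], the mean value theorem on [0, x] and on [x, 1/2]
   gives points where the decreasing function [pi cos (pi .)] is respectively
   below and above 2. *)
Lemma jordan_sin x : 0 <= x <= 2^-1 -> 2 * x <= sin (pi * x).
Proof.
move=> /andP[x0 x1]; have p0 := pi_gt0 R.
have [->|xn0] := eqVneq x 0; first by rewrite !mulr0 sin0.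
have [->|xn1] := eqVneq x 2^-1; first by rewrite sin_pihalf mulfV.
have {x0}x0 : 0 < x by rewrite lt_neqAle eq_sym xn0.
have {x1}x1 : x < 2^-1 by rewrite lt_neqAle xn1.
have der z : is_derive z (1 : R) (fun t : R => sin (pi * t)) (pi * cos (pi * z)).
  by apply: is_derive_eq; rewrite /GRing.scale/=; ring.
have cont a b : {within `[a, b], continuous (fun t : R => sin (pi * t))}.
  apply: continuous_subspaceT => z; apply: differentiable_continuous.
  by apply/derivable1_diffP; have [] := der z.
have [a] := MVT x0 (fun z _ => der z) (cont 0 x).
rewrite in_itv/= mulr0 sin0 !subr0 => /andP[a0 ax] Ea.
have [b] := MVT x1 (fun z _ => der z) (cont x 2^-1).
rewrite in_itv/= sin_pihalf => /andP[xb b1] Eb.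
have cosab : cos (pi * b) < cos (pi * a).
  rewrite ltr_cos ?in_itv/=; first by rewrite ltr_pM2l//; lra.
  - by rewrite !mulr_ge0 ?ltW//=; nra.
  - by rewrite !mulr_ge0 ?ltW//=; nra.
rewrite leNgt; apply/negP => sx.
have h1 : pi * cos (pi * a) < 2.
  by rewrite -(ltr_pM2r x0) -Ea.
have h2 : 2 < pi * cos (pi * b).
  by rewrite -(@ltr_pM2r _ (2^-1 - x)) ?subr_gt0// -Eb; lra.
have : pi * cos (pi * b) < pi * cos (pi * a) by rewrite ltr_pM2l.
lra.
Qed.

Definition dirichlet N y : R[i] :=
  \sum_(a <- int_segment N) expi (2 * pi * (y * a%:~R)).

Lemma size_int_segment N : size (int_segment N) = (2 * N + 1)%N.
Proof. by rewrite size_cat !size_map !size_iota; lia. Qed.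

Lemma cmod_dirichlet_le N y : cmod (dirichlet N y) <= (2 * N + 1)%:R.
Proof.
apply: le_trans (cmod_sum _ _ _) _.
under eq_bigr do rewrite cmod_expi.
by rewrite big_const_seq count_predT size_int_segment -Monoid.iteropE.
Qed.

(** The geometric sum in product form stays valid for integral [y], where the closed quotient would
    be 0/0. *)
Lemma dirichlet_telescope N y : (expi (2 * pi * y) - 1) * dirichlet N y =
  expi (2 * pi * (y * N.+1%:R)) - expi (2 * pi * (y * - N%:R)).
Proof.
elim: N => [|N IH].
  rewrite /dirichlet big_cat/= !big_cons !big_nil !addr0.
  by rewrite -[Posz 0]/(0 : int) mulr0z oppr0 !mulr0 expi0 !mulr1.
have -> : dirichlet N.+1 y = dirichlet N y +
    (expi (2 * pi * (y * N.+1%:R)) + expi (2 * pi * (y * - N.+1%:R))).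
  rewrite /dirichlet !big_cat !big_map.
  have iE n : iota 0 n = index_iota 0 n by rewrite /index_iota subn0.
  rewrite !iE big_nat_recr//= [in X in _ + X]big_nat_recr//= NegzE intrN.
  by rewrite addrACA.
have s1 : expi (2 * pi * y) * expi (2 * pi * (y * N.+1%:R)) =
    expi (2 * pi * (y * N.+2%:R)).
  by rewrite -expiD; congr expi; rewrite -[N.+2%:R]natr1; ring.
have s2 : expi (2 * pi * y) * expi (2 * pi * (y * - N.+1%:R)) =
    expi (2 * pi * (y * - N%:R)).
  by rewrite -expiD; congr expi; rewrite -natr1; ring.
rewrite mulrDr IH -s1 -s2; ring.
Qed.

(** Taking moduli in the telescoped identity gives 2 |sin(pi y)| |D_N(y)| <= 2, and Jordan's
    inequality bounds |sin(pi y)| below by twice the distance from y to the integers. *)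
Lemma dirichlet_le N y d : 0 < d -> (forall k : int, d <= `|y - k%:~R|) ->
  cmod (dirichlet N y) <= (2 * d)^-1.
Proof.
move=> d0 dy; have p0 := pi_gt0 R.
pose k := Num.floor (y + 2^-1); pose r := y - k%:~R.
have rI : - 2^-1 <= r <= 2^-1.
  have /andP[] := floor_itv (y + 2^-1); rewrite -/k intrD /r => *.
  by lra.
have sinE : `|sin (pi * y)| = sin (pi * `|r|).
  (* The two sines differ by a sign given by the parity of [k]; their squares depend only on the
     cosine of the double angle, which has period 2 pi. *)
  have -> : `|sin (pi * y)| = `|sin (pi * r)|.
    apply/eqP; rewrite -(@eqrXn2 _ 2)// !real_normK ?num_real//.
    have cos2 z : sin z ^+ 2 = (1 - cos (z *+ 2)) / 2 :> R.
      by rewrite cos_mulr2n sin2cos2 !mulr2n; field.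
    rewrite !cos2 -(cosD2piz (- k)) /r; apply/eqP; congr ((1 - cos _) / 2).
    by rewrite intrN; ring.
  have [r0|r0] := leP 0 r.
    by rewrite (ger0_norm r0) ger0_norm// sin_ge0_pi//; nra.
  by rewrite (ltr0_norm r0) mulrN sinN ler0_norm// -oppr_ge0 -sinN -mulrN sin_ge0_pi//; nra.
have s2d : 2 * d <= `|sin (pi * y)|.
  rewrite sinE; apply: le_trans (jordan_sin _).
    by rewrite ler_pM2l//; exact: dy.
  by rewrite normr_ge0 ler_norml.
have : cmod ((expi (2 * pi * y) - 1) * dirichlet N y) <= 2.
  rewrite dirichlet_telescope; apply: le_trans (cmodB_le _ _) _.
  by rewrite !cmod_expi.
rewrite cmodM -mulrA cmod_expi_sub1 => h.
rewrite -[leRHS]mul1r ler_pdivlMr ?mulr_gt0//.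
have := cmod_ge0 (dirichlet N y); nra.
Qed.

Lemma dist_Z2_le (x : 'cV[R]_2) (k0 k1 : int) :
  dist_Z2 x <= Num.sqrt ((x 0 0 - k0%:~R) ^+ 2 + (x 1 0 - k1%:~R) ^+ 2).
Proof.
apply: ge_inf; first by exists 0 => _ [z _ <-]; exact: sqrtr_ge0.
exists (map_mx intr (\col_i if i == 0 then k0 else k1)).
  by exists (\col_i if i == 0 then k0 else k1) => //; rewrite mul1mx.
rewrite /enorm /dotv big_ord_recl big_ord1 !mxE/=.
by rewrite (_ : lift ord0 ord0 = 1) ?expr2//; exact: val_inj.
Qed.

Lemma dirichlet2_le N (x : 'cV[R]_2) (c : R) : 0 < c -> c <= dist_Z2 x ->
  cmod (dirichlet N (x 0 0) * dirichlet N (x 1 0)) <=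
  (2 * N + 1)%:R * (Num.sqrt 2 / (2 * c)).
Proof.
move=> c0 cx.
(* The distance to Z^2 is tested at the point whose coordinates are the nearest integers. *)
have near y : exists k : int, forall l : int, `|y - k%:~R| <= `|y - l%:~R| :> R.
  exists (Num.floor (y + 2^-1)) => l.
  have /andP[] := floor_itv (y + 2^-1); rewrite intrD; set k := Num.floor _ => h1 h2.
  have [<-//|kl] := eqVneq k l.
  have : 1 <= `|k%:~R - l%:~R| :> R.
    by rewrite -intrB -intr_norm ler1z -gtz0_ge1 normr_gt0 subr_eq0.
  rewrite ler_norml; have [p|p] := leP 0 (k%:~R - l%:~R : R).
    rewrite ger0_norm// => h.
    by have [q|q] := leP 0 (y - l%:~R); rewrite ?(ger0_norm q) ?(ltr0_norm q); lra.
  rewrite ltr0_norm// => h.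
  by have [q|q] := leP 0 (y - l%:~R); rewrite ?(ger0_norm q) ?(ltr0_norm q); lra.
have [k0 hk0] := near (x 0 0); have [k1 hk1] := near (x 1 0).
set d0 := `|x 0 0 - _| in hk0; set d1 := `|x 1 0 - _| in hk1.
have cd : c ^+ 2 <= d0 ^+ 2 + d1 ^+ 2.
  rewrite /d0 /d1 !real_normK ?num_real//.
  have := le_trans cx (dist_Z2_le x k0 k1).
  set S := _ ^+ 2 + _ ^+ 2 => h.
  have S0 : 0 <= S by rewrite addr_ge0// sqr_ge0.
  by rewrite -(sqr_sqrtr S0) ler_sqr ?nnegrE ?sqrtr_ge0// ltW.
have s2 : 0 < Num.sqrt 2 :> R by rewrite sqrtr_gt0.
have s22 : Num.sqrt 2 ^+ 2 = 2 :> R by rewrite sqr_sqrtr.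
have big d : 0 <= d -> c ^+ 2 <= 2 * d ^+ 2 -> 0 < d /\ (2 * d)^-1 <= Num.sqrt 2 / (2 * c).
  move=> dge h; have dc : c <= Num.sqrt 2 * d.
    rewrite -(@ler_pXn2r _ 2) ?nnegrE ?mulr_ge0 ?(ltW c0) ?(ltW s2)//.
    by rewrite exprMn s22.
  have dgt : 0 < d by rewrite -(pmulr_rgt0 _ s2) (lt_le_trans c0).
  split=> //; rewrite ler_pdivlMr ?mulr_gt0// mulrC ler_pdivrMr ?mulr_gt0//; lra.
have c20 : 0 <= Num.sqrt 2 / (2 * c) by rewrite divr_ge0 ?mulr_ge0 ?ltW.
(* As c^2 <= d0^2 + d1^2, one coordinate has c^2 <= 2 d^2. Its kernel receives the decay bound and
   the other the trivial bound 2N+1. *)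
rewrite cmodM; have [h|h] := leP (c ^+ 2) (2 * d0 ^+ 2).
  have [d00 le0] := big d0 (normr_ge0 _) h.
  rewrite mulrC; apply: ler_pM; rewrite ?cmod_ge0 ?cmod_dirichlet_le//.
  exact: le_trans (dirichlet_le N d00 hk0) le0.
have [|d10 le1] := big d1 (normr_ge0 _); first by lra.
apply: ler_pM; rewrite ?cmod_ge0 ?cmod_dirichlet_le//.
exact: le_trans (dirichlet_le N d10 hk1) le1.
Qed.

End DirichletKernel.

(** * Translation invariance of Lebesgue measure in the plane *)

Section Translation.
Context {R : realType}.
Local Notation RR := (measurableTypeR R).
Local Notation lebesgue2 := (@lebesgue_measure R \x @lebesgue_measure R)%E.

Let addr_c (c : R) (x : RR) : RR := (x : R) + c.

Let measurable_addr c : measurable_fun setT (addr_c c).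
Proof. by apply: (@measurable_funD _ _ R); [exact: measurable_id|exact: measurable_cst]. Qed.

(** The image measure agrees with Lebesgue measure on half-open intervals, which determine it. *)
Lemma lebesgue_measure_translate (c : R) (E : set RR) : measurable E ->
  lebesgue_measure (addr_c c @^-1` E) = lebesgue_measure E.
Proof.
move=> mE.
pose f : {mfun RR >-> RR} :=
  HB.pack (addr_c c) (isMeasurableFun.Build _ _ _ _ (addr_c c) (measurable_addr c)).
rewrite -[LHS]/(pushforward (@lebesgue_measure R) f E).
symmetry; apply: lebesgue_measure_unique => // X [[a b] _ <-].
transitivity (lebesgue_measure (addr_c c @^-1` `]a, b]%classic)); last by [].
have -> : addr_c c @^-1` `]a, b]%classic = `](a - c), (b - c)]%classic.
  by apply/seteqP; split=> x /=; rewrite /addr_c !in_itv/= ltrBlDr lerBrDr.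
rewrite !lebesgue_measure_itv/= !lte_fin ltrD2r.
by case: ifP => // _; rewrite -!EFinB; congr _%:E; ring.
Qed.

Definition shift2 (w : R * R) (u : RR * RR) : RR * RR :=
  ((u.1 : R) + w.1, (u.2 : R) + w.2).

Lemma measurable_shift2 w : measurable_fun setT (shift2 w).
Proof.
apply/measurable_fun_pairP; split => /=.
- apply: (@measurable_funD _ _ R); [exact: measurable_fst|exact: measurable_cst].
- apply: (@measurable_funD _ _ R); [exact: measurable_snd|exact: measurable_cst].
Qed.

Lemma lebesgue2_translate w (E : set (RR * RR)) : measurable E ->
  lebesgue2 (shift2 w @^-1` E) = lebesgue2 E.
Proof.
move=> mE.
pose f : {mfun (RR * RR)%type >-> (RR * RR)%type} :=
  HB.pack (shift2 w) (isMeasurableFun.Build _ _ _ _ (shift2 w) (measurable_shift2 w)).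
rewrite -[LHS]/(pushforward lebesgue2 f E).
symmetry; apply: product_measure_unique => // A B mA mB.
transitivity (lebesgue2 ((addr_c w.1 @^-1` A) `*` (addr_c w.2 @^-1` B))).
  by [].
rewrite [LHS]product_measure1E.
- by congr (_ * _)%E; exact: lebesgue_measure_translate.
- by rewrite -[X in measurable X]setTI; exact: measurable_addr.
- by rewrite -[X in measurable X]setTI; exact: measurable_addr.
Qed.

Lemma Rintegral_translate w (E : set (RR * RR)) (F : RR * RR -> R) :
  measurable E -> measurable_fun setT F ->
  lebesgue2.-integrable (shift2 w @^-1` E) (EFin \o (F \o shift2 w)) ->
  \int[lebesgue2]_(u in shift2 w @^-1` E) F (shift2 w u) =
  \int[lebesgue2]_(u in E) F u.
Proof.
move=> mE mF iF.
pose f : {mfun (RR * RR)%type >-> (RR * RR)%type} :=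
  HB.pack (shift2 w) (isMeasurableFun.Build _ _ _ _ (shift2 w) (measurable_shift2 w)).
congr fine.
have -> : (\int[lebesgue2]_(u in E) (F u)%:E =
    \int[pushforward lebesgue2 f]_(u in E) (F u)%:E)%E.
  by apply: eq_measure_integral => A mA _; rewrite [RHS]lebesgue2_translate.
rewrite (integral_pushforward (measurable_shift2 w)) //.
exact/measurable_EFinP.
Qed.

End Translation.

(** * The unit cell of a lattice and the waves on it *)

Section Cell.
Context {R : realType}.
Variable M : 'M[R]_2.
Hypothesis hM : M \in unitmx.
Local Notation RR := (measurableTypeR R).
Local Notation lebesgue2 := (@lebesgue_measure R \x @lebesgue_measure R)%E.

Definition unpt (x : 'cV[R]_2) : R * R := (x 0 0, x 1 0).

Lemma cV2P (x y : 'cV[R]_2) : x 0 0 = y 0 0 -> x 1 0 = y 1 0 -> x = y.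
Proof.
move=> h0 h1; apply/colP => i; case: i => [[|[|//]] hi].
- by rewrite (_ : Ordinal hi = 0)//; exact: val_inj.
- by rewrite (_ : Ordinal hi = 1)//; exact: val_inj.
Qed.

Lemma pt0 (u : R * R) : pt u 0 0 = u.1.
Proof. by rewrite mxE. Qed.

Lemma pt1 (u : R * R) : pt u 1 0 = u.2.
Proof. by rewrite mxE. Qed.

Lemma unptK x : pt (unpt x) = x.
Proof. by apply: cV2P; rewrite ?pt0 ?pt1. Qed.

Lemma pt_shift2 (w u : R * R) : pt (shift2 w u) = pt u + pt w.
Proof. by apply: cV2P; rewrite [RHS]mxE !(pt0, pt1). Qed.

Lemma mulmx2E (N : 'M[R]_2) (x : 'cV[R]_2) i :
  (N *m x) i 0 = N i 0 * x 0 0 + N i 1 * x 1 0.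
Proof.
rewrite mxE big_ord_recl big_ord1.
by rewrite (_ : lift ord0 ord0 = 1)//; exact: val_inj.
Qed.

Definition coord (i : 'I_2) (x : 'cV[R]_2) : R := (invmx M *m x) i 0.

Lemma coordD i x y : coord i (x + y) = coord i x + coord i y.
Proof. by rewrite /coord mulmxDr mxE. Qed.

Lemma coord_mulmx i v : coord i (M *m v) = v i 0.
Proof. by rewrite /coord mulKmx. Qed.

Lemma coordK x : M *m (\col_i coord i x) = x.
Proof.
rewrite -[RHS](mulKVmx hM); congr mulmx.
by apply/colP => i; rewrite mxE.
Qed.

Lemma measurable_coord i : measurable_fun setT (fun u : RR * RR => coord i (pt u)).
Proof.
rewrite (_ : (fun u => _) = fun u : RR * RR =>
    invmx M i 0 * (u.1 : R) + invmx M i 1 * (u.2 : R)); last first.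
  by apply/funext => u; rewrite /coord mulmx2E pt0 pt1.
by apply: measurable_funD; apply: measurable_funM.
Qed.

Lemma unit_cellP x : unit_cell M x <-> forall i, 0 <= coord i x < 1.
Proof.
split=> [[t tP <-] i|h]; first by rewrite coord_mulmx; exact: tP.
by exists (\col_i coord i x); [move=> i /=; rewrite mxE|exact: coordK].
Qed.

Lemma latticeP x : lattice M x <->
  exists n : int * int, coord 0 x = n.1%:~R /\ coord 1 x = n.2%:~R.
Proof.
split=> [[n _ <-]|[n [h0 h1]]].
  by exists (n 0 0, n 1 0); rewrite !coord_mulmx !mxE.
exists (\col_i if i == 0 then n.1 else n.2) => //.
rewrite -[RHS]coordK; congr mulmx.
by apply: cV2P; rewrite !mxE/= ?h0 ?h1.
Qed.

Definition cell : set (RR * RR) := @pt R @^-1` unit_cell M.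

Lemma measurable_itv_preimage (F : RR * RR -> R) (i : interval R) :
  measurable_fun setT F -> measurable [set u | F u \in i].
Proof.
move=> mF; rewrite -[X in measurable X]setTI.
exact: (mF measurableT [set` i] (measurable_itv i)).
Qed.

Lemma cellE : cell = [set u | coord 0 (pt u) \in `[0, 1[] `&`
                     [set u | coord 1 (pt u) \in `[0, 1[].
Proof.
apply/seteqP; split=> u; rewrite /cell/= unit_cellP !in_itv/=.
  by move=> h; split; exact: h.
move=> [h0 h1] i; case: i => [[|[|//]] hi].
- by rewrite (_ : Ordinal hi = 0)//; exact: val_inj.
- by rewrite (_ : Ordinal hi = 1)//; exact: val_inj.
Qed.

Lemma measurable_cell : measurable cell.
Proof.
rewrite cellE; apply: measurableI; apply: measurable_itv_preimage;
  exact: measurable_coord.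
Qed.

Lemma cell_lty : (lebesgue2 cell < +oo)%E.
Proof.
(* Coordinates in the cell are below 1, so the i-th Cartesian coordinate is bounded by the i-th
   absolute row sum of [M]. *)
pose B i := `|M i 0| + `|M i 1|.
have sub : cell `<=` (`[- B 0, B 0] : set RR) `*` (`[- B 1, B 1] : set RR).
  move=> u; rewrite cellE/= !in_itv/= => -[/andP[a0 a1] /andP[b0 b1]].
  have bnd i : - B i <= (pt u) i 0 <= B i.
    rewrite -ler_norml -(coordK (pt u)) mulmx2E !mxE.
    rewrite (le_trans (ler_normD _ _))// !normrM lerD// ler_piMr//.
    - by rewrite ger0_norm// ltW.
    - by rewrite ger0_norm// ltW.
  by have := (bnd 0, bnd 1); rewrite pt0 pt1 => -[].
pose I0 : set RR := `[- B 0, B 0]%classic; pose I1 : set RR := `[- B 1, B 1]%classic.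
have mB : (lebesgue2 (I0 `*` I1) < +oo)%E.
  rewrite [X in (X < _)%E]product_measure1E; [|exact: measurable_itv..].
  rewrite [X in (X * _)%E]lebesgue_measure_itv [X in (_ * X)%E]lebesgue_measure_itv/=.
  apply: lte_mul_pinfty => //; case: ifP => // _; rewrite -EFinB ?ltry// lee_fin.
  by rewrite opprK /B !addr_ge0.
apply: le_lt_trans mB; apply: (le_measure lebesgue2 _ _ sub).
- by rewrite inE; exact: measurable_cell.
- by rewrite inE; apply: measurableX; exact: measurable_itv.
Qed.

Lemma cell_fin_num : lebesgue2 cell \is a fin_num.
Proof. by rewrite ge0_fin_numE// cell_lty. Qed.

Lemma bmeas_cell_integrable (F : RR * RR -> R) : bmeas F ->
  lebesgue2.-integrable cell (EFin \o F).
Proof.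
move=> [mF [C FC]]; apply: measurable_bounded_integrable.
- exact: measurable_cell.
- exact: cell_lty.
- exact: measurable_funTS.
- by exists C; split=> [|B CB u _]; [exact: num_real|exact: le_trans (FC u) (ltW CB)].
Qed.

Lemma bmeas_shift2 w (F : RR * RR -> R) : bmeas F -> bmeas (F \o shift2 w).
Proof.
move=> [mF [C FC]]; split; last by exists C => u; exact: FC.
exact: measurableT_comp mF (measurable_shift2 w).
Qed.

(* Translating the cell by [c] times the [i]-th edge and moving the part that
   sticks out back by one edge gives the cell again. *)
Lemma Rintegral_antiperiodic i (c : R) (F : RR * RR -> R) :
  0 <= c <= 1 -> bmeas F ->
  (forall u, F (shift2 (unpt (M *m (c *: delta_mx i 0))) u) = - F u) ->
  (forall u, F (shift2 (unpt (M *m ((c - 1) *: delta_mx i 0))) u) = - F u) ->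
  \int[lebesgue2]_(u in cell) F u = 0.
Proof.
move=> /andP[c0 c1] bF F1 F2.
have mF : measurable_fun setT F by case: bF.
have mci : measurable_fun setT (fun u : RR * RR => coord i (pt u)).
  exact: measurable_coord.
have mcell := measurable_cell.
have coord_shift a u j :
    coord j (pt (shift2 (unpt (M *m (a *: delta_mx i 0))) u)) =
    coord j (pt u) + a * (j == i)%:R.
  by rewrite pt_shift2 unptK coordD coord_mulmx !mxE eqxx andbT.
have part (S S' : set (RR * RR)) w : measurable S -> measurable S' ->
    S `<=` cell -> shift2 w @^-1` S' = S ->
    (forall u, F (shift2 w u) = - F u) ->
    \int[lebesgue2]_(u in S') F u = - \int[lebesgue2]_(u in S) F u.
  move=> mS mS' Sc SS' Fw; rewrite -(@Rintegral_translate _ w)// SS'.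
    under eq_Rintegral do rewrite Fw.
    rewrite -mulN1r -RintegralZl//.
      by apply: eq_Rintegral => u _; rewrite mulN1r.
    by apply: integrableS (bmeas_cell_integrable bF).
  by apply: integrableS (bmeas_cell_integrable (bmeas_shift2 w bF)).
have split (a : R) : \int[lebesgue2]_(u in cell) F u =
    \int[lebesgue2]_(u in cell `&` [set u | coord i (pt u) \in `[a, +oo[]) F u +
    \int[lebesgue2]_(u in cell `&` [set u | coord i (pt u) \in `]-oo, a[]) F u.
  rewrite -Rintegral_setU.
  - congr Rintegral; rewrite -setIUr; apply/seteqP; split=> [u cu|u []//].
    split=> //=; rewrite !in_itv/= andbT.
    by have [|] := leP a (coord i (pt u)); [left|right].
  - by apply: measurableI => //; exact: measurable_itv_preimage.
  - by apply: measurableI => //; exact: measurable_itv_preimage.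
  - rewrite -setIUr; apply: integrableS (bmeas_cell_integrable bF) => //.
    by apply: measurableI => //; apply: measurableU; exact: measurable_itv_preimage.
  - apply/disj_setPS => u [[_ /=]]; rewrite in_itv/= andbT => h [_ /=].
    by rewrite in_itv/= ltNge h.
have shift_cell a u : cell (shift2 (unpt (M *m (a *: delta_mx i 0))) u) <->
    (0 <= coord i (pt u) + a < 1 /\ forall j, j != i -> 0 <= coord j (pt u) < 1).
  rewrite /cell/= unit_cellP; split=> [h|[h1 h2] j].
    split=> [|j ji].
      by have := h i; rewrite coord_shift eqxx mulr1.
    by have := h j; rewrite coord_shift (negbTE ji) mulr0 addr0.
  rewrite coord_shift; have [->|ji] := eqVneq j i; first by rewrite mulr1.
  by rewrite mulr0 addr0; exact: h2.
have cell_split u : cell u <->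
    (0 <= coord i (pt u) < 1 /\ forall j, j != i -> 0 <= coord j (pt u) < 1).
  rewrite /cell/= unit_cellP; split=> [h|[h1 h2] j]; first by split.
  by have [->//|] := eqVneq j i; exact: h2.
have oppK (x : R) : x = - x -> x = 0 by lra.
(* With t the i-th lattice coordinate, the part t < c is the translate by c - 1 of t >= 1 - c, and
   the part t >= c is the translate by c of t < 1 - c. Both translations flip the sign of F, so the
   integral is its own opposite. *)
apply: oppK; rewrite [LHS](split c) [in RHS](split (1 - c)) opprD addrC; congr (_ + _).
- apply: (part _ _ (unpt (M *m ((c - 1) *: delta_mx i 0)))) => //.
  + by apply: measurableI => //; exact: measurable_itv_preimage.
  + by apply: measurableI => //; exact: measurable_itv_preimage.
  apply/seteqP; split=> u /=; rewrite !in_itv/= ?andbT coord_shift eqxx mulr1.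
    move=> [/shift_cell[/andP[h1 h2] h3] h4]; split; last by lra.
    by apply/cell_split; split=> //; lra.
  move=> [/cell_split[/andP[h1 h2] h3] h4]; split; last by lra.
  by apply/shift_cell; split=> //; lra.
- apply: (part _ _ (unpt (M *m (c *: delta_mx i 0)))) => //.
  + by apply: measurableI => //; exact: measurable_itv_preimage.
  + by apply: measurableI => //; exact: measurable_itv_preimage.
  apply/seteqP; split=> u /=; rewrite !in_itv/= ?andbT coord_shift eqxx mulr1.
    move=> [/shift_cell[/andP[h1 h2] h3] h4]; split; last by lra.
    by apply/cell_split; split=> //; lra.
  move=> [/cell_split[/andP[h1 h2] h3] h4]; split; last by lra.
  by apply/shift_cell; split=> //; lra.
Qed.

(** This is G.x / (2 pi) for the dual vector G = 2 pi M^(-T) m. *)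
Definition phase (m : int * int) (x : 'cV[R]_2) : R :=
  m.1%:~R * coord 0 x + m.2%:~R * coord 1 x.

Lemma phaseD m x y : phase m (x + y) = phase m x + phase m y.
Proof. by rewrite /phase !coordD; ring. Qed.

(** The shift [p] covers the cosine (p = 0) and the sine (p = -pi/2) at once. *)
Definition wave (m : int * int) (p : R) (u : RR * RR) : R :=
  cos (2 * pi * phase m (pt u) + p).

Lemma wave_le1 m p u : `|wave m p u| <= 1.
Proof. by rewrite ler_norml cos_geN1 cos_le1. Qed.

Lemma bmeas_wave m p : bmeas (wave m p).
Proof.
split; last by exists 1 => u; exact: wave_le1.
apply: measurableT_comp; first by apply: continuous_measurable_fun; exact: continuous_cos.
apply: measurable_funD => //; apply: measurable_funM => //.
by apply: measurable_funD; apply: measurable_funM => //; exact: measurable_coord.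
Qed.

Lemma waveM m n p r u : wave m p u * wave n r u =
  2^-1 * (wave (m + n) (p + r) u + wave (m - n) (p - r) u).
Proof.
rewrite /wave.
have -> : 2 * pi * phase (m + n) (pt u) + (p + r) =
  (2 * pi * phase m (pt u) + p) + (2 * pi * phase n (pt u) + r).
  by rewrite /phase !intrD; ring.
have -> : 2 * pi * phase (m - n) (pt u) + (p - r) =
  (2 * pi * phase m (pt u) + p) - (2 * pi * phase n (pt u) + r).
  by rewrite /phase !intrD !intrN; ring.
set a := 2 * pi * _ + p; set b := 2 * pi * _ + r.
by rewrite (cosD a b) cosB; field.
Qed.

Lemma phase_edge m i (a : R) x : phase m (x + M *m (a *: delta_mx i 0)) =
  phase m x + a * (if i == 0 then m.1 else m.2)%:~R.
Proof.
rewrite phaseD; congr (_ + _); rewrite /phase !coord_mulmx !mxE eqxx !andbT.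
by case: i => [[|[|//]] hi] /=; ring.
Qed.

Lemma Rintegral_wave m p : m != 0 -> \int[lebesgue2]_(u in cell) wave m p u = 0.
Proof.
move=> m0.
have [i ki0] : exists i : 'I_2, (if i == 0 then m.1 else m.2) != 0.
  have [m10|m10] := eqVneq m.1 0; last by exists 0.
  exists 1 => /=; apply: contraNN m0 => /eqP m20.
  by rewrite [m]surjective_pairing m10 m20.
set k := (if i == 0 then m.1 else m.2) in ki0 *.
have kR0 : k%:~R != 0 :> R by rewrite intr_eq0.
have k1 : 1 <= `|k%:~R| :> R by rewrite -intr_norm ler1z -gtz0_ge1 normr_gt0.
(* Moving by c along this edge changes the phase by half a turn. The shift by c - 1 differs from it
   by k whole turns, so it flips the sign as well. *)
pose c : R := (2 * `|k%:~R|)^-1.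
have c01 : 0 <= c <= 1.
  by rewrite invr_ge0 mulr_ge0//= invf_le1; lra.
have ck : 2 * pi * (c * k%:~R) = pi \/ 2 * pi * (c * k%:~R) = - pi.
  have [kp|kn] := leP 0 (k%:~R : R).
    by left; rewrite /c ger0_norm//; field.
  by right; rewrite /c ltr0_norm//; field.
have anti x : cos (x + 2 * pi * (c * k%:~R)) = - cos x.
  case: ck => ->; first by rewrite cosDpi.
  by rewrite -[x in RHS](subrK pi) cosDpi opprK.
apply: (@Rintegral_antiperiodic i c) => //; first exact: bmeas_wave.
- move=> u; rewrite /wave pt_shift2 unptK phase_edge -/k -anti; congr cos; ring.
- move=> u; rewrite /wave pt_shift2 unptK phase_edge -/k -anti.
  rewrite -[RHS](cosD2piz (- k)); congr cos; rewrite intrN; ring.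
Qed.

Lemma Rintegral_wave0 p : \int[lebesgue2]_(u in cell) wave 0 p u = cos p * area (unit_cell M).
Proof.
rewrite -[RHS](Rintegral_cst _ measurable_cell).
by apply: eq_Rintegral => u _; rewrite /wave /phase !mul0r addr0 mulr0 add0r.
Qed.

(** A product of two waves is an average of two waves, so orthogonality to all of them survives
    multiplication by one. *)
Lemma multiplier_wave (h : RR * RR -> R) m p :
  lebesgue2.-integrable cell (EFin \o h) ->
  multiplier lebesgue2 cell h (fun a => wave a.1 a.2) (wave m p).
Proof.
move=> ih; split; first exact: bmeas_wave.
move=> v bv ov [n r] /=.
have ip k s : lebesgue2.-integrable cell (EFin \o (fun u => h u * (v u * wave k s u))).
  exact: (bmeas_integrable measurable_cell ih (bmeasM bv (bmeas_wave k s))).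
have iD : lebesgue2.-integrable cell (EFin \o (fun u =>
    h u * (v u * wave (m + n) (p + r) u) + h u * (v u * wave (m - n) (p - r) u))).
  rewrite (_ : (fun u => _ + _) =
      h \* ((v \* wave (m + n) (p + r)) \+ (v \* wave (m - n) (p - r)))).
    apply: bmeas_integrable => //; first exact: measurable_cell.
    by apply: bmeasD; apply: bmeasM => //; exact: bmeas_wave.
  by apply/funext => u /=; ring.
transitivity (\int[lebesgue2]_(u in cell) (2^-1 *
   (h u * (v u * wave (m + n) (p + r) u) + h u * (v u * wave (m - n) (p - r) u)))).
  by apply: eq_Rintegral => u _; rewrite -[v u * _ * _]mulrA waveM; ring.
rewrite RintegralZl//; last exact: measurable_cell.
rewrite RintegralD//; last exact: measurable_cell.
by rewrite (ov (m + n, p + r)) (ov (m - n, p - r)) addr0 mulr0.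
Qed.

(** The angle runs through [-pi b, 2 pi - pi b), one full period, on which the cosine is at least
    cos(pi b) exactly on [-pi b, pi b]. *)
Lemma cos_le_arc (b t : R) : 0 <= b <= 1 -> 0 <= t < 1 ->
  (cos (pi * b) <= cos (2 * pi * t - pi * b)) = (t <= b).
Proof.
move=> /andP[b0 b1] /andP[t0 t1]; have p0 := pi_gt0 R.
have mono : {in `[0, pi] &, {mono (@cos R) : x y /~ y <= x}}.
  move=> x y xI yI; rewrite !leNgt; congr (~~ _); exact: ltr_cos.
have pb : 0 <= pi * b <= pi by rewrite mulr_ge0 ?ler_piMr// ltW.
have [tb|bt] := leP t b.
  rewrite -(cos_norm (2 * pi * t - pi * b)).
  have xb : `|2 * pi * t - pi * b| <= pi * b by rewrite ler_norml; nra.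
  rewrite mono ?in_itv//=; rewrite normr_ge0/=; apply: le_trans xb _; lra.
apply/negbTE; rewrite -ltNge.
have [xp|xp] := leP (2 * pi * t - pi * b) pi.
  by rewrite ltr_cos ?in_itv//= ?pb ?xp ?andbT//; nra.
have -> : cos (2 * pi * t - pi * b) = cos (2 * pi - (2 * pi * t - pi * b)).
  by rewrite -[LHS]cosN -[LHS](cosD2piz 1); congr cos; ring.
by rewrite ltr_cos ?in_itv//= ?pb//; nra.
Qed.

Lemma phase_unit i x :
  phase (if i == 0 then (1, 0) else (0, 1)) x = coord i x.
Proof.
rewrite /phase; case: i => [[|[|//]] hi] /=; rewrite mul1r mul0r ?addr0 ?add0r;
by congr coord; exact: val_inj.
Qed.

(** * Uniqueness of Fourier coefficients for integrable functions *)

Section Uniqueness.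
Variable h : RR * RR -> R.
Hypothesis ih : lebesgue2.-integrable cell (EFin \o h).
Let mult := multiplier lebesgue2 cell h (fun a => wave a.1 a.2).
Let mcell := measurable_cell.
Let bw (a : (int * int) * R) : bmeas (wave a.1 a.2).
Proof. exact: bmeas_wave. Qed.

Let multiplier_coord_le i (b : R) :
  mult (\1_[set u : RR * RR | coord i (pt u) <= b]).
Proof.
have bE : bmeas (\1_[set u : RR * RR | coord i (pt u) <= b] : RR * RR -> R).
  split; last by exists 1 => u; rewrite indicE; case: (_ \in _); rewrite /= ?normr1 ?normr0.
  apply: measurable_indic.
  rewrite (_ : [set u | _] = [set u : RR * RR | coord i (pt u) \in `]-oo, b]]).
    by apply: measurable_itv_preimage; exact: measurable_coord.
  by apply/seteqP; split=> u /=; rewrite in_itv.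
have inc u : u \in cell -> 0 <= coord i (pt u) < 1.
  by rewrite inE /cell/= unit_cellP; exact.
(* For b outside [0, 1] the indicator is constant on the cell, and only values on the cell
   matter. *)
have [b0|b0] := ltP b 0.
  apply: (@multiplier_eq_on _ _ _ lebesgue2 cell h _ _ (cst 0)) => //.
    move=> u uc /=; rewrite indicE memNset//= => tb.
    by have := inc _ uc; lra.
  exact: multiplier_cst.
have [b1|b1] := leP b 1; last first.
  apply: (@multiplier_eq_on _ _ _ lebesgue2 cell h _ _ (cst 1)) => //.
    move=> u uc /=; rewrite indicE mem_set//=.
    by have := inc _ uc; lra.
  exact: multiplier_cst.
pose m : int * int := if i == 0 then (1, 0) else (0, 1).
have pm x : phase m x = coord i x by exact: phase_unit.
apply: (@multiplier_eq_on _ _ _ lebesgue2 cell h _ _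
  (\1_[set u | cos (pi * b) <= wave m (- (pi * b)) u])) => //.
  move=> u uc; rewrite !indicE; congr (_%:R); congr (nat_of_bool _).
  by apply/idP/idP; rewrite !inE /= /wave pm cos_le_arc ?b0 ?b1//; exact: inc.
apply: multiplier_ge => //.
- by move=> u; exact: wave_le1.
- by rewrite cos_geN1 cos_le1.
- exact: multiplier_wave.
Qed.

(** [T'] is the plane with the sigma-algebra of multiplier sets. Lattice coordinates are measurable
    for it, hence so are the Cartesian ones; thus the identity from [T'] to the Borel plane is
    measurable, which is the claim. *)
Let multiplier_measurable (E : set (RR * RR)) : measurable E -> mult (\1_E).
Proof.
pose S := [set E : set (RR * RR) | mult (\1_E)].
have sS : sigma_algebra setT S by exact: sigma_algebra_multiplier.
pose T' := g_sigma_algebraType S.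
have mS (A : set T') : measurable A = S A.
  by rewrite /measurable/= (sigma_algebra_id sS).
have mc i : measurable_fun setT (fun u : T' => coord i (pt (u : RR * RR)) : RR).
  apply: (measurability _ (RGenOInfty.measurableE R)) => _ [_ [x ->] <-].
  rewrite setTI mS.
  rewrite (_ : _ @^-1` _ = ~` [set u : RR * RR | coord i (pt u) <= x]).
    have [_ SC _] := sS; rewrite -setTD; apply: SC; exact: multiplier_coord_le.
  apply/seteqP; split=> u /=; rewrite in_itv/= andbT ltNge; first by move/negP.
  by move=> /negP.
have mid : measurable_fun setT (fun u : T' => (u : RR * RR)).
  apply/measurable_fun_pairP; split.
  - rewrite (_ : _ \o _ = fun u : T' => M 0 0 * coord 0 (pt (u : RR * RR)) +
        M 0 1 * coord 1 (pt (u : RR * RR))).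
      by apply: (@measurable_funD _ _ R); apply: (@measurable_funM _ _ R) => //; exact: mc.
    by apply/funext => u /=; rewrite -[LHS]pt0 -[in LHS](coordK (pt u)) mulmx2E !mxE.
  - rewrite (_ : _ \o _ = fun u : T' => M 1 0 * coord 0 (pt (u : RR * RR)) +
        M 1 1 * coord 1 (pt (u : RR * RR))).
      by apply: (@measurable_funD _ _ R); apply: (@measurable_funM _ _ R) => //; exact: mc.
    by apply/funext => u /=; rewrite -[LHS]pt1 -[in LHS](coordK (pt u)) mulmx2E !mxE.
move=> mE; have := mid measurableT _ mE.
by rewrite setTI mS.
Qed.

Lemma fourier_uniqueness :
  (forall m p, \int[lebesgue2]_(u in cell) (h u * wave m p u) = 0) ->
  {ae lebesgue2, forall u, cell u -> h u = 0}.
Proof.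
move=> h0; apply: (multiplier_all_ae0 mcell ih) multiplier_measurable.
- move=> [m p] /=; rewrite -[RHS](h0 m p).
  by apply: eq_Rintegral => u _; rewrite mul1r.
- exists (0, 0) => u /=; rewrite /wave /phase !mul0r !addr0 mulr0.
  exact: cos0.
Qed.

End Uniqueness.

Lemma cell_repr x : exists2 y, unit_cell M y & lattice M (x - y).
Proof.
exists (M *m \col_i (coord i x - (Num.floor (coord i x))%:~R)).
  apply/unit_cellP => // i; rewrite coord_mulmx mxE.
  have /andP[f1 f2] := floor_itv (coord i x).
  by move: f1 f2; rewrite intrD; lra.
apply/latticeP; exists (Num.floor (coord 0 x), Num.floor (coord 1 x)).
rewrite -[X in coord 0 (X - _)]coordK -[X in coord 1 (X - _)]coordK -mulmxBr.
by rewrite !coord_mulmx !mxE /= !opprB !addrA; split; ring.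
Qed.

(** This turns almost everywhere statements into pointwise ones for continuous functions: near any
    point of the cell there is a box of positive measure inside the cell. *)
Lemma cell_ae_dense (P : set (R * R)) x (U : set 'cV[R]_2) :
  {ae lebesgue2, forall u, cell u -> P u} -> unit_cell M x -> nbhs x U ->
  exists u, [/\ cell u, P u & U (pt u)].
Proof.
move=> [N [mN N0 PN]] xc /nbhs_ballP[e /= e0 eU].
pose C1 := 1 + \sum_i (`|M i 0| + `|M i 1|).
pose C2 := 1 + \sum_i (`|invmx M i 0| + `|invmx M i 1|).
have C1M i : `|M i 0| + `|M i 1| < C1.
  rewrite /C1 (bigD1 i)//= addrCA ltrDl.
  by rewrite (@lt_le_trans _ _ 1)// lerDl sumr_ge0.
have C2M i : `|invmx M i 0| + `|invmx M i 1| < C2.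
  rewrite /C2 (bigD1 i)//= addrCA ltrDl.
  by rewrite (@lt_le_trans _ _ 1)// lerDl sumr_ge0.
have C10 : 0 < C1 by apply: le_lt_trans (C1M 0); rewrite addr_ge0.
have C20 : 0 < C2 by apply: le_lt_trans (C2M 0); rewrite addr_ge0.
have x01 := (unit_cellP x).1 xc.
have [d d0 [dt0 dt1 de]] : exists2 d : R, 0 < d &
    [/\ coord 0 x + 2 * d < 1, coord 1 x + 2 * d < 1 & d * C1 < e / 2].
  pose d := Num.min ((1 - coord 0 x) / 3) (Num.min ((1 - coord 1 x) / 3) (e / (3 * C1))).
  have /andP[_ h0] := x01 0; have /andP[_ h1] := x01 1.
  exists d; first by rewrite !lt_min !divr_gt0 ?subr_gt0 ?mulr_gt0.
  have : d <= (1 - coord 0 x) / 3 by rewrite ge_min lexx.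
  have : d <= (1 - coord 1 x) / 3 by rewrite !ge_min lexx orbT.
  have : d <= e / (3 * C1) by rewrite !ge_min lexx !orbT.
  rewrite ler_pdivlMr ?mulr_gt0// => *; split; nra.
(* The point [x] may lie on a lower edge of the cell; [y] is pushed inward by d in both lattice
   coordinates, so that a box around it fits. *)
pose y := x + M *m (\col_i d).
pose r := Num.min (d / C2) (e / 2).
have r0 : 0 < r by rewrite lt_min !divr_gt0.
pose I0 : set RR := `](y 0 0 - r), (y 0 0 + r)[%classic.
pose I1 : set RR := `](y 1 0 - r), (y 1 0 + r)[%classic.
have box i u : (I0 `*` I1) u -> `|pt u i 0 - y i 0| < r.
  rewrite /I0 /I1 /= !in_itv/= => -[/andP[a1 a2] /andP[b1 b2]].
  case: i => [[|[|//]] hi].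
    by rewrite (_ : Ordinal hi = 0) ?pt0; [rewrite ltr_norml; lra|exact: val_inj].
  by rewrite (_ : Ordinal hi = 1) ?pt1; [rewrite ltr_norml; lra|exact: val_inj].
have boxc u : (I0 `*` I1) u -> cell u.
  move=> bu; rewrite /cell/= unit_cellP => i.
  have : `|coord i (pt u - y)| < d.
    rewrite /coord mulmx2E (le_lt_trans (ler_normD _ _))// !normrM.
    have h0 : `|(pt u - y) 0 0| <= r by rewrite mxE [X in _ + X]mxE ltW// box.
    have h1 : `|(pt u - y) 1 0| <= r by rewrite mxE [X in _ + X]mxE ltW// box.
    have rd : r * C2 <= d by rewrite -ler_pdivlMr// ge_min lexx.
    have ci := C2M i.
    have := ler_wpM2l (normr_ge0 (invmx M i 0)) h0.
    have := ler_wpM2l (normr_ge0 (invmx M i 1)) h1.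
    nra.
  have -> : coord i (pt u) = coord i (pt u - y) + coord i x + d.
    have cy : coord i y = coord i x + d by rewrite coordD coord_mulmx mxE.
    by rewrite -addrA -cy -coordD subrK.
  have := x01 i; rewrite ltr_norml.
  have : coord i x + 2 * d < 1.
    case: i => [[|[|//]] hi].
      by rewrite (_ : Ordinal hi = 0)//; exact: val_inj.
    by rewrite (_ : Ordinal hi = 1)//; exact: val_inj.
  by move=> h /andP[? ?] /andP[? ?]; lra.
have boxU u : (I0 `*` I1) u -> U (pt u).
  move=> bu; apply: eU; split=> // i j; rewrite (ord1 j) /ball/= distrC.
  have yx : `|y i 0 - x i 0| < e / 2.
    rewrite /y [(x + _) i 0]mxE addrC addKr mulmx2E !mxE -mulrDl normrM.
    rewrite (gtr0_norm d0) mulrC; apply: le_lt_trans de.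
    by rewrite ler_wpM2l ?ltW// (le_lt_trans (ler_normD _ _)).
  have rb := box i u bu; have re : r <= e / 2 by rewrite ge_min lexx orbT.
  rewrite (le_lt_trans (ler_distD (y i 0) _ _))//; lra.
have mu0 : (0 < lebesgue2 (I0 `*` I1))%E.
  rewrite [X in (_ < X)%E]product_measure1E; [|exact: measurable_itv..].
  rewrite [X in (X * _)%E]lebesgue_measure_itv [X in (_ * X)%E]lebesgue_measure_itv/=.
  rewrite !lte_fin !ifT; [|lra..].
  by rewrite -!EFinB -EFinM lte_fin mulr_gt0//; lra.
have [u [bu Nu]] : exists u, (I0 `*` I1) u /\ ~ N u.
  apply: contrapT => /forallNP H; move: mu0.
  suff -> : lebesgue2 (I0 `*` I1) = 0%E by rewrite ltxx.
  apply: (subset_measure0 _ mN _ N0).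
    by apply: measurableX; exact: measurable_itv.
  by move=> u bu; apply: contrapT => Nu; apply: (H u).
exists u; split; [exact: boxc| |exact: boxU].
apply: contrapT => nP; apply: Nu; apply: PN => /= H; apply: nP; apply: H.
exact: boxc.
Qed.

(** If the cell were null, the false predicate would hold almost everywhere on it, hence at some
    point. *)
Lemma area_gt0 : 0 < area (unit_cell M).
Proof.
rewrite /area lt_neqAle fine_ge0// andbT eq_sym.
rewrite fine_eq0; last exact: cell_fin_num.
apply/eqP => mu0.
have [u []//] : exists u, [/\ cell u, False & setT (pt u)].
apply: (@cell_ae_dense (fun=> False) 0) => //; last exact: filterT.
  exists cell; split => //; first exact: measurable_cell.
  by move=> u /= /not_implyP[].
by apply/unit_cellP => i; rewrite /coord mulmx0 mxE lexx ltr01.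
Qed.

Lemma continuous_periodic_ae_eq (F G : 'cV[R]_2 -> R) :
  continuous F -> continuous G ->
  (forall x y, lattice M y -> F (x + y) = F x) ->
  (forall x y, lattice M y -> G (x + y) = G x) ->
  {ae lebesgue2, forall u, cell u -> F (pt u) = G (pt u)} -> F =1 G.
Proof.
move=> cF cG pF pG FG x; have [y yc xy] := cell_repr x.
rewrite -(subrK y x) addrC pF// pG//.
apply: contrapT => /eqP FGy.
have : \forall z \near y, F z - G z != 0.
  have cFG : {for y, continuous (fun z => F z - G z)}.
    by apply: continuousB; [exact: cF|exact: cG].
  by apply: (cvgr_neq0 _ cFG); rewrite subr_eq0.
move=> /(cell_ae_dense FG yc)[u [_ /= ->]].
by rewrite subrr eqxx.
Qed.

(** * Absolutely convergent trigonometric series *)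

Section TrigonometricSeries.
Variables (B : int * int -> R) (a b : int * int -> R).
Hypothesis sB : summable2 B.
Hypothesis aB : forall n, `|a n| <= B n.
Hypothesis bB : forall n, `|b n| <= B n.

(** The real part of (a + i b) e^(2 pi i phase). Replacing (a, b) by (b, -a) gives the imaginary
    part. *)
Definition trig_term (n : int * int) (x : 'cV[R]_2) : R :=
  a n * cos (2 * pi * phase n x) - b n * sin (2 * pi * phase n x).

Definition trig_series (x : 'cV[R]_2) : R := limn (psum (trig_term ^~ x)).

Let B2 n := 2 * B n.

Let sB2 : summable2 B2.
Proof.
have [B0 [C BC]] := sB; split; first by move=> n; rewrite mulr_ge0.
by exists (2 * C) => s us; rewrite -mulr_sumr ler_pM2l// BC.
Qed.

Lemma trig_term_le n x : `|trig_term n x| <= B2 n.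
Proof.
rewrite (le_trans (ler_normB _ _))// !normrM.
have hc := cos_max (2 * pi * phase n x); have hs := sin_max (2 * pi * phase n x).
have h1 : `|a n| * `|cos (2 * pi * phase n x)| <= B n.
  by rewrite (le_trans _ (aB n))// ler_piMr.
have h2 : `|b n| * `|sin (2 * pi * phase n x)| <= B n.
  by rewrite (le_trans _ (bB n))// ler_piMr.
by rewrite /B2; lra.
Qed.

Lemma trig_series_cvg x :
  psum (trig_term ^~ x) k @[k --> \oo] --> trig_series x.
Proof. by apply: summable2_cvg sB2 _ => n; exact: trig_term_le. Qed.

Lemma trig_series_periodic x y : lattice M y ->
  trig_series (x + y) = trig_series x.
Proof.
move=> /latticeP[n [y0 y1]]; congr (limn (psum _)); apply/funext => m.
have pE : 2 * pi * phase m (x + y) =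
    2 * pi * phase m x + 2 * pi * (m.1 * n.1 + m.2 * n.2)%:~R.
  by rewrite phaseD {2}/phase y0 y1 intrD !intrM; ring.
by rewrite /trig_term pE cosD2piz sinD2piz.
Qed.

Lemma continuous_coord i : continuous (coord i).
Proof.
rewrite (_ : coord i = fun y : 'cV[R]_2 =>
    (invmx M i 0 * y 0 0 + invmx M i 1 * y 1 0 : R)); last first.
  by apply/funext => y; rewrite /coord mulmx2E.
move=> x.
have h k : {for x, continuous (fun y : 'cV[R]_2 => (invmx M i k * y k 0 : R))}.
  by apply: continuousM; [exact: cst_continuous|exact: coord_continuous].
exact: (continuousD (h 0) (h 1)).
Qed.

Lemma continuous_phase n : continuous (phase n).
Proof.
move=> x.
have h (k : int) i : {for x, continuous (fun y : 'cV[R]_2 => (k%:~R * coord i y : R))}.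
  by apply: continuousM; [exact: cst_continuous|exact: continuous_coord].
exact: (continuousD (h n.1 0) (h n.2 1)).
Qed.

Lemma continuous_trig_term n : continuous (trig_term n).
Proof.
move=> x; have cp : {for x, continuous (fun y => 2 * pi * phase n y)}.
  by apply: continuousM; [exact: cst_continuous|exact: continuous_phase].
have h1 : {for x, continuous (fun y => a n * cos (2 * pi * phase n y))}.
  apply: continuousM; first exact: cst_continuous.
  exact: (continuous_comp cp (@continuous_cos R _)).
have h2 : {for x, continuous (fun y => b n * sin (2 * pi * phase n y))}.
  apply: continuousM; first exact: cst_continuous.
  exact: (continuous_comp cp (@continuous_sin R _)).
exact: (continuousB h1 h2).
Qed.

Lemma continuous_trig_psum k : continuous (fun x => psum (trig_term ^~ x) k).
Proof.
move=> x; rewrite /psum -/(continuous_at x _); elim: (int2_enum k) => [|n s IH].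
  by under eq_fun do rewrite big_nil; exact: cst_continuous.
under eq_fun do rewrite big_cons.
by apply: continuousD; [exact: continuous_trig_term|exact: IH].
Qed.

Lemma continuous_trig_series : continuous trig_series.
Proof.
move=> x; have FF : Filter (nbhs x) := nbhs_filter x.
apply/cvgrPdist_lt => e e0.
have e3 : 0 < e / 3 by rewrite divr_gt0.
have /cvgrPdist_lt/(_ _ e3) := summable2_tail_cvg sB2.
move=> [k _ /(_ k (leqnn k))]; rewrite /= sub0r normrN => tk.
have tail y : `|trig_series y - psum (trig_term ^~ y) k| < e / 3.
  apply: le_lt_trans (summable2_tail k sB2 (fun n => trig_term_le n y)) _.
  exact: le_lt_trans (ler_norm _) tk.
have /cvgrPdist_lt/(_ _ e3) := @continuous_trig_psum k x.
apply: filterS => y h; have hx := tail x; have hy := tail y.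
move: h hx hy; rewrite !ltr_norml => /andP[? ?] /andP[? ?] /andP[? ?].
by apply/andP; split; lra.
Qed.

Lemma trig_termE n u :
  trig_term n (pt u) = a n * wave n 0 u - b n * wave n (- (pi / 2)) u.
Proof. by rewrite /trig_term /wave addr0 cosBpihalf. Qed.

Lemma bmeas_trig_term n : bmeas (fun u : RR * RR => trig_term n (pt u)).
Proof.
rewrite (_ : (fun u => _) = (cst (a n) \* wave n 0) \+
    (cst (- b n) \* wave n (- (pi / 2)))).
  by apply: bmeasD; apply: bmeasM; (try exact: bmeas_cst); exact: bmeas_wave.
by apply/funext => u; rewrite trig_termE /= mulNr.
Qed.

Lemma bmeas_trig_sum s :
  bmeas (fun u : RR * RR => \sum_(n <- s) trig_term n (pt u)).
Proof.
elim: s => [|n s IH]; first by under eq_fun do rewrite big_nil; exact: bmeas_cst.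
by under eq_fun do rewrite big_cons; exact: bmeasD (bmeas_trig_term n) IH.
Qed.

Lemma trig_series_bcvg : bcvg (fun k (u : RR * RR) => psum (trig_term ^~ (pt u)) k)
  (fun u => trig_series (pt u)).
Proof.
split.
- by move=> k; have [] := bmeas_trig_sum (int2_enum k).
- have [B0 [C BC]] := sB2; exists C => k u.
  apply: le_trans (BC _ (int2_enum_uniq k)).
  rewrite (le_trans (ler_norm_sum _ _ _))// ler_sum// => n _.
  exact: trig_term_le.
- by move=> u; exact: trig_series_cvg.
Qed.

Let integrable_wave m p : lebesgue2.-integrable cell (EFin \o wave m p).
Proof. exact/bmeas_cell_integrable/bmeas_wave. Qed.

(** The product has frequencies n + m and n - m, and only frequency 0 has a nonzero mean; when n = m
    = 0 both terms count. *)
Lemma Rintegral_wave_trig_term m p n :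
  \int[lebesgue2]_(u in cell) (wave m p u * trig_term n (pt u)) =
  area (unit_cell M) * (2^-1 * ((n == m)%:R * (a n * cos p + b n * sin p) +
                                (n == - m)%:R * (a n * cos p - b n * sin p))).
Proof.
have wE k r : \int[lebesgue2]_(u in cell) wave k r u =
    (k == 0)%:R * (area (unit_cell M) * cos r).
  have [->|k0] := eqVneq k 0; first by rewrite Rintegral_wave0// mul1r mulrC.
  by rewrite Rintegral_wave// mul0r.
pose w1 := wave (n + m) p; pose w2 := wave (n - m) (- p).
pose w3 := wave (n + m) (- (pi / 2) + p); pose w4 := wave (n - m) (- (pi / 2) - p).
transitivity (\int[lebesgue2]_(u in cell)
    ((2^-1 * a n) * (w1 u + w2 u) - (2^-1 * b n) * (w3 u + w4 u))).
  apply: eq_Rintegral => u _; rewrite trig_termE mulrBr.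
  rewrite mulrCA [wave m p u * (b n * _)]mulrCA.
  rewrite [wave m p u * wave n 0 u]mulrC [wave m p u * wave n _ u]mulrC.
  by rewrite !waveM add0r sub0r /w1 /w2 /w3 /w4; ring.
have ibm (v : RR * RR -> R) : bmeas v -> lebesgue2.-integrable cell (EFin \o v).
  exact: bmeas_cell_integrable.
have mcell := measurable_cell.
have b12 : bmeas (fun u : RR * RR => w1 u + w2 u) by apply: bmeasD; exact: bmeas_wave.
have b34 : bmeas (fun u : RR * RR => w3 u + w4 u) by apply: bmeasD; exact: bmeas_wave.
have b12' : bmeas (fun u : RR * RR => 2^-1 * a n * (w1 u + w2 u)).
  exact: (bmeasM (bmeas_cst _ (2^-1 * a n)) b12).
have b34' : bmeas (fun u : RR * RR => 2^-1 * b n * (w3 u + w4 u)).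
  exact: (bmeasM (bmeas_cst _ (2^-1 * b n)) b34).
rewrite RintegralB//; last 2 first.
- exact: ibm b12'.
- exact: ibm b34'.
rewrite !RintegralZl//; [|exact: ibm|exact: ibm].
rewrite !RintegralD//; try exact: integrable_wave.
rewrite !wE addr_eq0 subr_eq0 cosN.
have -> : cos (- (pi / 2) + p) = sin p by rewrite addrC cosBpihalf.
have -> : cos (- (pi / 2) - p) = - sin p.
  by rewrite -cosN opprB opprK cosDpihalf.
ring.
Qed.

Lemma Rintegral_wave_trig_sum m p s :
  \int[lebesgue2]_(u in cell) (wave m p u * \sum_(n <- s) trig_term n (pt u)) =
  \sum_(n <- s) \int[lebesgue2]_(u in cell) (wave m p u * trig_term n (pt u)).
Proof.
elim: s => [|n s IH].
  rewrite big_nil; under eq_Rintegral do rewrite big_nil mulr0.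
  by rewrite Rintegral_cst ?mul0r//; exact: measurable_cell.
rewrite big_cons -IH; under eq_Rintegral do rewrite big_cons mulrDr.
rewrite RintegralD//; first exact: measurable_cell.
- exact/bmeas_cell_integrable/(bmeasM (bmeas_wave m p))/bmeas_trig_term.
- exact/bmeas_cell_integrable/(bmeasM (bmeas_wave m p))/bmeas_trig_sum.
Qed.

Lemma Rintegral_wave_trig_series m p :
  \int[lebesgue2]_(u in cell) (wave m p u * trig_series (pt u)) =
  area (unit_cell M) * (2^-1 * ((a m + a (- m)) * cos p +
                                (b m - b (- m)) * sin p)).
Proof.
have pick (E : seq (int * int)) (X : int * int -> R) k : uniq E -> k \in E ->
    \sum_(n <- E) (n == k)%:R * X n = X k.
  move=> uE kE; rewrite (bigD1_seq k)//= eqxx mul1r big1 ?addr0// => n /negbTE ->.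
  by rewrite mul0r.
have lim1 := Rintegral_bcvg measurable_cell (integrable_wave m p) trig_series_bcvg.
apply: (cvg_unique (@norm_hausdorff _ _) lim1).
(* Once the enumeration has passed both m and -m the moment no longer changes. *)
apply: cvg_near_cst; near=> k.
have mk : m \in int2_enum k.
  by rewrite mem_int2_enum; near: k; exact: nbhs_infty_gt.
have nmk : - m \in int2_enum k.
  by rewrite mem_int2_enum; near: k; exact: nbhs_infty_gt.
rewrite /psum Rintegral_wave_trig_sum.
under eq_bigr do rewrite Rintegral_wave_trig_term.
rewrite -!mulr_sumr big_split/= !pick ?int2_enum_uniq//; ring.
Unshelve. all: by end_near. Qed.

(** The cosine and sine moments determine those at every shift p through the addition formula, so
    the difference of F and the series has all moments zero. *)
Lemma trig_series_ae (F : RR * RR -> R) :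
  lebesgue2.-integrable cell (EFin \o F) ->
  (forall m, 2 * \int[lebesgue2]_(u in cell) (F u * wave m 0 u) =
     area (unit_cell M) * (a m + a (- m))) ->
  (forall m, 2 * \int[lebesgue2]_(u in cell) (F u * wave m (- (pi / 2)) u) =
     area (unit_cell M) * (b (- m) - b m)) ->
  {ae lebesgue2, forall u, cell u -> F u = trig_series (pt u)}.
Proof.
move=> iF Fa Fb; have mcell := measurable_cell.
have bT := bcvg_bmeas trig_series_bcvg.
have iT := bmeas_cell_integrable bT.
suff : {ae lebesgue2, forall u, cell u -> F u - trig_series (pt u) = 0}.
  by apply: filterS => u h /h /eqP; rewrite subr_eq0 => /eqP.
apply: fourier_uniqueness.
  rewrite (_ : EFin \o _ = (EFin \o F) \- (EFin \o (fun u => trig_series (pt u))))%E//.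
  exact: integrableB.
move=> m p.
have iFw r : lebesgue2.-integrable cell (EFin \o (fun u => F u * wave m r u)).
  exact: (bmeas_integrable mcell iF (bmeas_wave m r)).
transitivity (\int[lebesgue2]_(u in cell)
    (F u * wave m p u - wave m p u * trig_series (pt u))).
  by apply: eq_Rintegral => u _; ring.
rewrite RintegralB//; last exact: bmeas_cell_integrable (bmeasM (bmeas_wave m p) bT).
rewrite Rintegral_wave_trig_series.
transitivity (\int[lebesgue2]_(u in cell)
    (cos p * (F u * wave m 0 u) - sin p * (F u * wave m (- (pi / 2)) u)) -
    area (unit_cell M) * (2^-1 * ((a m + a (- m)) * cos p + (b m - b (- m)) * sin p))).
  congr (_ - _); apply: eq_Rintegral => u _.
  by rewrite /wave cosD addr0 cosBpihalf; ring.
rewrite RintegralB//; last 2 first.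
- exact: (integrableZl mcell (cos p) (iFw 0)).
- exact: (integrableZl mcell (sin p) (iFw (- (pi / 2)))).
rewrite !RintegralZl//.
have h1 := Fa m; have h2 := Fb m.
set I0 := Rintegral _ _ _ in h1 *; set I1 := Rintegral _ _ _ in h2 *.
have -> : I0 = 2^-1 * (area (unit_cell M) * (a m + a (- m))) by rewrite -h1; field.
have -> : I1 = 2^-1 * (area (unit_cell M) * (b (- m) - b m)) by rewrite -h2; field.
ring.
Qed.

End TrigonometricSeries.

End Cell.

(** * Euclidean and spectral norms, integer vectors, dual lattice *)

Section PlaneGeometry.
Context {R : realType}.
Implicit Types (x y : 'cV[R]_2) (A M : 'M[R]_2).

Lemma dotvE x y : dotv x y = x 0 0 * y 0 0 + x 1 0 * y 1 0.
Proof.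
rewrite /dotv big_ord_recl big_ord1.
by rewrite (_ : lift ord0 ord0 = 1)//; exact: val_inj.
Qed.

Lemma dotv_trmx A x y : dotv (A^T *m x) y = dotv x (A *m y).
Proof. by rewrite !dotvE !mulmx2E !mxE; ring. Qed.

Lemma dotv_ge0 x : 0 <= dotv x x.
Proof. by rewrite dotvE -!expr2 addr_ge0// sqr_ge0. Qed.

Lemma enorm_ge0 x : 0 <= enorm x.
Proof. exact: sqrtr_ge0. Qed.

Lemma sqr_enorm x : enorm x ^+ 2 = dotv x x.
Proof. by rewrite sqr_sqrtr// dotv_ge0. Qed.

Lemma enorm_eq0 x : enorm x = 0 -> x = 0.
Proof.
move=> /(congr1 (fun t => t ^+ 2)); rewrite sqr_enorm expr0n/= dotvE -!expr2.
move=> /eqP; rewrite paddr_eq0 ?sqr_ge0// !sqrf_eq0 => /andP[/eqP x0 /eqP x1].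
by apply: cV2P; rewrite mxE.
Qed.

Lemma enormZ (c : R) x : enorm (c *: x) = `|c| * enorm x.
Proof.
rewrite /enorm -sqrtr_sqr -sqrtrM ?sqr_ge0//; congr Num.sqrt.
by rewrite !dotvE !mxE; ring.
Qed.

Lemma dotv_le x y : dotv x y <= enorm x * enorm y.
Proof.
have [|h] := leP (dotv x y) 0.
  by move=> /le_trans; apply; rewrite mulr_ge0 ?enorm_ge0.
rewrite -(@ler_pXn2r _ 2) ?nnegrE ?mulr_ge0 ?enorm_ge0 ?(ltW h)//.
rewrite exprMn !sqr_enorm !dotvE.
(* Lagrange's identity in the plane. *)
rewrite -subr_ge0 (_ : _ - _ = (x 0 0 * y 1 0 - x 1 0 * y 0 0) ^+ 2) ?sqr_ge0//.
ring.
Qed.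

(** Only for a set bounded above does [sup] dominate the elements, as needed below. *)
Lemma spectral_norm_has_ubound A :
  has_ubound [set enorm (A *m x) | x in [set x | enorm x <= 1]].
Proof.
pose C := `|A 0 0| + `|A 0 1| + `|A 1 0| + `|A 1 1|.
exists (2 * C) => _ [x /= x1 <-].
have xi : `|x 0 0| <= 1 /\ `|x 1 0| <= 1.
  have : enorm x ^+ 2 <= 1 by rewrite exprn_ile1 ?enorm_ge0.
  by rewrite sqr_enorm dotvE !ler_norml => *; split; nra.
have C0 : 0 <= C by rewrite /C !addr_ge0.
rewrite -(@ler_pXn2r _ 2) ?nnegrE ?mulr_ge0 ?enorm_ge0// sqr_enorm.
have hi i : `|(A *m x) i 0| <= `|A i 0| + `|A i 1|.
  rewrite mulmx2E (le_trans (ler_normD _ _))// !normrM lerD// ler_piMr//; by case: xi.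
have h0 : (A *m x) 0 0 ^+ 2 <= C ^+ 2.
  rewrite -real_normK ?num_real// lerXn2r ?nnegrE// (le_trans (hi 0))// /C.
  by rewrite -addrA lerDl addr_ge0.
have h1 : (A *m x) 1 0 ^+ 2 <= C ^+ 2.
  rewrite -real_normK ?num_real// lerXn2r ?nnegrE// (le_trans (hi 1))// /C.
  by rewrite -addrA lerDr addr_ge0.
by rewrite dotvE; nra.
Qed.

Lemma spectral_norm_ge0 A : 0 <= spectral_norm A.
Proof.
apply: le_trans (_ : enorm (A *m 0) <= _); first exact: enorm_ge0.
apply: ub_le_sup; first exact: spectral_norm_has_ubound.
by exists 0 => //=; rewrite /enorm dotvE !mxE mulr0 addr0 sqrtr0 ler01.
Qed.

Lemma enorm_mulmx_le A x : enorm (A *m x) <= spectral_norm A * enorm x.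
Proof.
have [x0|x0] := eqVneq (enorm x) 0.
  by rewrite (enorm_eq0 x0) mulmx0 /enorm dotvE !mxE !mulr0 addr0 sqrtr0 mulr0.
have xp : 0 < enorm x by rewrite lt_neqAle eq_sym x0 enorm_ge0.
rewrite -ler_pdivrMr// mulrC -[(enorm x)^-1]ger0_norm ?invr_ge0 ?enorm_ge0//.
rewrite -enormZ scalemxAr; apply: ub_le_sup; first exact: spectral_norm_has_ubound.
exists ((enorm x)^-1 *: x) => //=.
by rewrite enormZ ger0_norm ?invr_ge0 ?enorm_ge0// mulVf.
Qed.

(** |A^T x|^2 = x . A (A^T x) <= |x| ||A|| |A^T x|, then cancel one factor. *)
Lemma enorm_trmx_mulmx_le A x : enorm (A^T *m x) <= spectral_norm A * enorm x.
Proof.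
have [x0|x0] := eqVneq (enorm (A^T *m x)) 0.
  by rewrite x0 mulr_ge0 ?spectral_norm_ge0 ?enorm_ge0.
have xp : 0 < enorm (A^T *m x) by rewrite lt_neqAle eq_sym x0 enorm_ge0.
rewrite -(ler_pM2r xp) -expr2 sqr_enorm dotv_trmx.
apply: le_trans (dotv_le _ _) _.
rewrite mulrC -mulrA [enorm x * _]mulrC mulrA ler_wpM2r ?enorm_ge0//.
exact: enorm_mulmx_le.
Qed.

Definition zvec (m : int * int) : 'cV[R]_2 :=
  \col_i (if i == 0 then m.1 else m.2)%:~R.

Lemma zvec0E m : zvec m 0 0 = m.1%:~R. Proof. by rewrite mxE. Qed.
Lemma zvec1E m : zvec m 1 0 = m.2%:~R. Proof. by rewrite mxE. Qed.

Lemma zvecN m : zvec (- m) = - zvec m.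
Proof. by apply: cV2P; rewrite !mxE/= intrN. Qed.

Lemma map_mx_zvec (n : 'cV[int]_2) : map_mx intr n = zvec (n 0 0, n 1 0).
Proof. by apply: cV2P; rewrite !mxE. Qed.

Lemma zvecE m : zvec m = map_mx intr (\col_i if i == 0 then m.1 else m.2).
Proof. by apply: cV2P; rewrite !mxE. Qed.

Lemma enorm_zvecN m : enorm (zvec (- m)) = enorm (zvec m).
Proof. by rewrite zvecN -scaleN1r enormZ normrN1 mul1r. Qed.

Lemma enorm_zvec_ge1 m : m != 0 -> 1 <= enorm (zvec m).
Proof.
move=> m0; rewrite -(@ler_pXn2r _ 2) ?nnegrE ?enorm_ge0// expr1n sqr_enorm.
rewrite dotvE zvec0E zvec1E -!rmorphM -rmorphD -[1]/(1%:~R) ler_int.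
case: m m0 => a b /= ab0; rewrite -gtz0_ge1 -!expr2.
rewrite lt_neqAle addr_ge0 ?sqr_ge0// andbT eq_sym paddr_eq0 ?sqr_ge0// !sqrf_eq0.
by apply: contraNN ab0 => /andP[/eqP-> /eqP->].
Qed.

Lemma lattice_weightE t m : lattice_weight t m = enorm (zvec m) `^ (- (2 * t)).
Proof.
rewrite /lattice_weight -mulrN powRrM powR_mulrn ?enorm_ge0// sqr_enorm dotvE.
by rewrite zvec0E zvec1E !expr2.
Qed.

Definition freq M (m : int * int) : 'cV[R]_2 :=
  (2 * pi) *: ((invmx M)^T *m zvec m).

Lemma dotv_freq M m x : dotv (freq M m) x = 2 * pi * phase M m x.
Proof.
rewrite dotvE /phase /coord !mulmx2E /freq.
have sE (c : R) (y : 'cV[R]_2) i : (c *: y) i 0 = c * y i 0 by rewrite mxE.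
have tE (N : 'M[R]_2) i j : N^T i j = N j i by rewrite mxE.
by rewrite !sE !mulmx2E !zvec0E !zvec1E !tE; ring.
Qed.

Lemma dual_latticeP M G : dual_lattice M G <-> exists m, G = freq M m.
Proof.
split=> [[_ [n _ <-] <-]|[m ->]].
  by exists (n 0 0, n 1 0); rewrite map_mx_zvec.
exists ((invmx M)^T *m zvec m) => //.
by exists (\col_i if i == 0 then m.1 else m.2) => //; rewrite -zvecE.
Qed.

Lemma phaseE M m x : phase M m x = dotv (zvec m) (invmx M *m x).
Proof. by rewrite dotvE zvec0E zvec1E. Qed.

End PlaneGeometry.

(* [P], [P'] play the cosine and [Q], [Q'] the sine moments of the real and
   imaginary parts, [re], [im] the complex coefficients they determine. *)
Lemma fcoef_symmetry {R : realType} (c : R) (P Q P' Q' re im : int * int -> R) :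
  c != 0 -> (forall m, P (- m) = P m) -> (forall m, Q (- m) = - Q m) ->
  (forall m, P' (- m) = P' m) -> (forall m, Q' (- m) = - Q' m) ->
  (forall m, re m = c^-1 * (P m + Q m)) ->
  (forall m, im m = c^-1 * (P' m - Q' m)) -> forall m,
  ((2 * P m = c * (re m + re (- m))) * (2 * Q' m = c * (im (- m) - im m))) *
  ((2 * P' m = c * (im m + im (- m))) * (2 * Q m = c * (- re (- m) - - re m))).
Proof.
move=> c0 PN QN PN' QN' reE imE m; rewrite !reE !imE PN QN PN' QN'.
by split; split; field.
Qed.

(** * The Fourier series as the continuous representative *)

Section FourierSeries.
Context {R : realType}.
Variables (M : 'M[R]_2) (f : 'cV[R]_2 -> R[i]).
Hypothesis hM : M \in unitmx.
Hypothesis hf : cintegrable (unit_cell M) f.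
Local Notation RR := (measurableTypeR R).
Local Notation lebesgue2 := (@lebesgue_measure R \x @lebesgue_measure R)%E.

Definition fcoef (m : int * int) : R[i] := fourier_coef M f (freq M m).

Definition fre (u : RR * RR) : R := complex.Re (f (pt u)).
Definition fim (u : RR * RR) : R := complex.Im (f (pt u)).

Let ire : lebesgue2.-integrable (cell M) (EFin \o fre). Proof. exact: hf.1. Qed.
Let iim : lebesgue2.-integrable (cell M) (EFin \o fim). Proof. exact: hf.2. Qed.
Let mcell : measurable (cell M) := measurable_cell hM.

Let int_wave (F : RR * RR -> R) m p : R :=
  \int[lebesgue2]_(u in cell M) (F u * wave M m p u).

Let iwave F m p : lebesgue2.-integrable (cell M) (EFin \o F) ->
  lebesgue2.-integrable (cell M) (EFin \o (fun u => F u * wave M m p u)).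
Proof. by move=> iF; exact: (bmeas_integrable mcell iF (bmeas_wave M m p)). Qed.

Lemma Re_expiM t (z : R[i]) :
  complex.Re (expi t * z) = cos t * complex.Re z - sin t * complex.Im z.
Proof. by case: z. Qed.

Lemma Im_expiM t (z : R[i]) :
  complex.Im (expi t * z) = cos t * complex.Im z + sin t * complex.Re z.
Proof. by case: z. Qed.

Lemma Re_fcoef m : complex.Re (fcoef m) = (area (unit_cell M))^-1 *
  (int_wave fre m 0 + int_wave fim m (- (pi / 2))).
Proof.
rewrite /fcoef /fourier_coef /cmean -fmorphV Re_realM; congr (_ * _).
rewrite -RintegralD//; [|exact: iwave|exact: iwave].
apply: eq_Rintegral => u _; rewrite Re_expiM dotv_freq cosN sinN mulNr opprK.
by rewrite /wave addr0 cosBpihalf mulrC [X in _ + X]mulrC.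
Qed.

Lemma Im_fcoef m : complex.Im (fcoef m) = (area (unit_cell M))^-1 *
  (int_wave fim m 0 - int_wave fre m (- (pi / 2))).
Proof.
rewrite /fcoef /fourier_coef /cmean -fmorphV Im_realM; congr (_ * _).
rewrite -RintegralB//; [|exact: iwave|exact: iwave].
apply: eq_Rintegral => u _; rewrite Im_expiM dotv_freq cosN sinN mulNr.
by rewrite /wave addr0 cosBpihalf mulrC [X in _ - X]mulrC.
Qed.

Let phaseN m x : phase M (- m) x = - phase M m x.
Proof. by rewrite /phase !intrN; ring. Qed.

Let int_waveN0 F m : int_wave F (- m) 0 = int_wave F m 0.
Proof.
apply: eq_Rintegral => u _; congr (_ * _).
by rewrite /wave !addr0 phaseN mulrN cosN.
Qed.

Let int_waveNs F m : lebesgue2.-integrable (cell M) (EFin \o F) ->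
  int_wave F (- m) (- (pi / 2)) = - int_wave F m (- (pi / 2)).
Proof.
move=> iF; rewrite -[RHS]mulN1r /int_wave -RintegralZl//; last exact: iwave.
apply: eq_Rintegral => u _.
by rewrite /wave !cosBpihalf phaseN mulrN sinN; ring.
Qed.

Variable B : int * int -> R.
Hypothesis sB : summable2 B.
Hypothesis cB : forall m, cmod (fcoef m) <= B m.

Let ReB m : `|complex.Re (fcoef m)| <= B m.
Proof. exact: le_trans (norm_Re_le _) (cB m). Qed.
Let ImB m : `|complex.Im (fcoef m)| <= B m.
Proof. exact: le_trans (norm_Im_le _) (cB m). Qed.
Let NReB m : `|- complex.Re (fcoef m)| <= B m.
Proof. by rewrite normrN. Qed.

Definition fseries (x : 'cV[R]_2) : R[i] := Complex
  (trig_series M (fun m => complex.Re (fcoef m)) (fun m => complex.Im (fcoef m)) x)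
  (trig_series M (fun m => complex.Im (fcoef m)) (fun m => - complex.Re (fcoef m)) x).

Lemma fseries_representative : continuous_representative M f fseries.
Proof.
have a0 : area (unit_cell M) != 0 by rewrite gt_eqF// area_gt0.
split.
- exact: (continuous_trig_series sB ReB ImB).
- exact: (continuous_trig_series sB ImB NReB).
- by move=> x y My; rewrite /fseries !(trig_series_periodic hM _ _ x My).
(* Each part of a coefficient mixes a moment of Re f with one of Im f; their opposite parities in m
   let m and -m together separate them. *)
have S := fcoef_symmetry a0 (int_waveN0 fre) (fun m => int_waveNs m iim)
  (int_waveN0 fim) (fun m => int_waveNs m ire) Re_fcoef Im_fcoef.
have hRe := trig_series_ae hM sB ReB ImB ire (fun m => (S m).1.1) (fun m => (S m).1.2).
have hIm := trig_series_ae hM sB ImB NReB iim (fun m => (S m).2.1) (fun m => (S m).2.2).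
move: hRe hIm; apply: filterS2 => u hr hi cu.
by apply: complexP; rewrite /fseries/=; [exact: hr|exact: hi].
Qed.

(** The theorem speaks of an arbitrary representative; this replaces it by the series at every
    point. *)
Lemma representative_unique g : continuous_representative M f g -> g =1 fseries.
Proof.
move=> [cr ci pg fg]; have [cr' ci' pg' fg'] := fseries_representative.
have gg : {ae lebesgue2, forall u, cell M u -> g (pt u) = fseries (pt u)}.
  have h1 : {ae lebesgue2, forall u, cell M u -> f (pt u) = g (pt u)} := fg.
  have h2 : {ae lebesgue2, forall u, cell M u -> f (pt u) = fseries (pt u)} := fg'.
  by move: h1 h2; apply: filterS2 => u h h' cu; rewrite -h// h'.
move=> x; apply: complexP.
- apply: (continuous_periodic_ae_eq hM cr cr') => [y z /pg->|y z /pg'->|]//.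
  by move: gg; apply: filterS => u h cu; rewrite h.
- apply: (continuous_periodic_ae_eq hM ci ci') => [y z /pg->|y z /pg'->|]//.
  by move: gg; apply: filterS => u h cu; rewrite h.
Qed.

Definition fpartial (k : nat) (x : 'cV[R]_2) : R[i] :=
  \sum_(m <- int2_enum k) fcoef m * expi (2 * pi * phase M m x).

Lemma Re_fpartial_cvg x :
  complex.Re (fpartial k x) @[k --> \oo] --> complex.Re (fseries x).
Proof.
have -> : (fun k => complex.Re (fpartial k x)) = psum (trig_term M
    (fun m => complex.Re (fcoef m)) (fun m => complex.Im (fcoef m)) ^~ x).
  apply/funext => k; rewrite /fpartial Re_sum; apply: eq_bigr => m _.
  by rewrite mulrC Re_expiM /trig_term; ring.
exact: (trig_series_cvg sB ReB ImB).
Qed.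

Lemma Im_fpartial_cvg x :
  complex.Im (fpartial k x) @[k --> \oo] --> complex.Im (fseries x).
Proof.
have -> : (fun k => complex.Im (fpartial k x)) = psum (trig_term M
    (fun m => complex.Im (fcoef m)) (fun m => - complex.Re (fcoef m)) ^~ x).
  apply/funext => k; rewrite /fpartial Im_sum; apply: eq_bigr => m _.
  by rewrite mulrC Im_expiM /trig_term; ring.
exact: (trig_series_cvg sB ImB NReB).
Qed.

Lemma fcoef0 : fcoef 0 = cmean (unit_cell M) f.
Proof.
rewrite /fcoef /fourier_coef; congr cmean; apply/funext => x.
by rewrite dotv_freq /phase !mul0r addr0 mulr0 oppr0 expi0 mul1r.
Qed.

End FourierSeries.

(** * Geometry of the two layers and of the moire lattice *)

Section MoireLattice.
Context {R : realType}.
Implicit Types (A X Y : 'M[R]_2) (x y z : 'cV[R]_2) (q theta : R).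

Lemma mx2P X Y : X 0 0 = Y 0 0 -> X 0 1 = Y 0 1 -> X 1 0 = Y 1 0 ->
  X 1 1 = Y 1 1 -> X = Y.
Proof.
move=> h00 h01 h10 h11; apply/matrixP => i j.
have ord2 (k : 'I_2) : k = 0 \/ k = 1.
  by case: k => [[|[|//]] hk]; [left|right]; exact: val_inj.
by have [->|->] := ord2 i; have [->|->] := ord2 j.
Qed.

Lemma mulmx22E X Y i j : (X *m Y) i j = X i 0 * Y 0 j + X i 1 * Y 1 j.
Proof.
rewrite mxE big_ord_recl big_ord1.
by rewrite (_ : lift ord0 ord0 = 1)//; exact: val_inj.
Qed.

Lemma rotationE (a : R) : ((rotation a 0 0 = cos a) * (rotation a 0 1 = - sin a) *
  (rotation a 1 0 = sin a) * (rotation a 1 1 = cos a))%type.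
Proof. by rewrite !mxE. Qed.

Lemma rotationD (a b : R) : rotation a *m rotation b = rotation (a + b).
Proof. by apply: mx2P; rewrite mulmx22E !rotationE ?cosD ?sinD; ring. Qed.

Lemma rotation0 : rotation 0 = 1%:M :> 'M[R]_2.
Proof. by apply: mx2P; rewrite rotationE ?cos0 ?sin0 ?oppr0 mxE. Qed.

Lemma rotation_tr (a : R) : (rotation a)^T = rotation (- a).
Proof.
by apply: mx2P; rewrite [LHS]mxE !rotationE ?cosN ?sinN ?opprK.
Qed.

Lemma invmx_left X Y : X *m Y = 1%:M -> invmx Y = X.
Proof.
move=> XY; have [_ uY] := mulmx1_unit XY.
by rewrite -[LHS]mul1mx -XY mulmxK.
Qed.

Section Layers.
Variables (A : 'M[R]_2) (q theta : R).
Hypotheses (hA : A \in unitmx) (hq : 0 < q).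
Hypothesis hinc : incommensurate A q theta.

Let r : R := q `^ (2^-1).
Let r0 : 0 < r. Proof. exact: powR_gt0. Qed.
Let rV : q `^ (- 2^-1) = r^-1. Proof. by rewrite powRN. Qed.
Let rr : r * r = q.
Proof. by rewrite /r powR12_sqrt ?ltW// -expr2 sqr_sqrtr// ltW. Qed.
Let rrV : r^-1 * r^-1 = q^-1. Proof. by rewrite -invfM rr. Qed.

Local Notation A1 := (layer_mx A q theta layer1).
Local Notation A2 := (layer_mx A q theta layer2).

Lemma layer1E : A1 = r^-1 *: (rotation (- (theta / 2)) *m A).
Proof. by rewrite /layer_mx rV. Qed.

Lemma invmx_layer1 : invmx A1 = r *: (invmx A *m rotation (theta / 2)).
Proof.
apply: invmx_left; rewrite layer1E -scalemxAl -scalemxAr scalerA mulfV ?gt_eqF// scale1r.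
by rewrite mulmxA -(mulmxA (invmx A)) rotationD subrr rotation0 mulmx1 mulVmx.
Qed.

Lemma invmx_layer2 : invmx A2 = r^-1 *: (invmx A *m rotation (- (theta / 2))).
Proof.
apply: invmx_left; rewrite /layer_mx -/r -scalemxAl -scalemxAr scalerA mulVf ?gt_eqF// scale1r.
by rewrite mulmxA -(mulmxA (invmx A)) rotationD addNr rotation0 mulmx1 mulVmx.
Qed.

Lemma rotation_unit (a : R) : rotation a \in unitmx.
Proof.
have : rotation a *m rotation (- a) = 1%:M by rewrite rotationD subrr rotation0.
by move/mulmx1_unit => [].
Qed.

Lemma layer_unit j : layer_mx A q theta j \in unitmx.
Proof.
case: j; rewrite ?layer1E /layer_mx unitmxZ ?unitmx_mul ?rotation_unit ?hA//.
- by rewrite unitfE invr_eq0 gt_eqF.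
- by rewrite unitfE gt_eqF.
Qed.

(** A_M^(-1) = A^(-1) [twist]. Its rows are (u, -v) and (v, u), so it is a similarity of ratio
    sqrt(u^2 + v^2), the inverse of the moire length ratio. *)
Definition twist : 'M[R]_2 :=
  r *: rotation (theta / 2) - r^-1 *: rotation (- (theta / 2)).

Definition twist_sqr : R := (r - r^-1) ^+ 2 + 4 * sin (theta / 2) ^+ 2.

Lemma invmx_layerB : invmx A1 - invmx A2 = invmx A *m twist.
Proof. by rewrite invmx_layer1 invmx_layer2 mulmxBr -!scalemxAr. Qed.

Let u : R := (r - r^-1) * cos (theta / 2).
Let v : R := (r + r^-1) * sin (theta / 2).

Let twistE : (twist 0 0 = u) * (twist 0 1 = - v) * (twist 1 0 = v) * (twist 1 1 = u).
Proof.
have e i j : twist i j =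
    r * rotation (theta / 2) i j - r^-1 * rotation (- (theta / 2)) i j.
  by rewrite !mxE.
by rewrite !e !rotationE cosN sinN /u /v; do !split; ring.
Qed.

Let uvE : u ^+ 2 + v ^+ 2 = twist_sqr.
Proof.
have rrV1 : r * r^-1 = 1 by rewrite mulfV// gt_eqF.
have -> : u ^+ 2 + v ^+ 2 =
    (r - r^-1) ^+ 2 * (cos (theta / 2) ^+ 2 + sin (theta / 2) ^+ 2) +
    4 * (r * r^-1) * sin (theta / 2) ^+ 2.
  by rewrite /u /v; ring.
by rewrite cos2Dsin2 rrV1 !mulr1.
Qed.

(** Otherwise r = r^(-1) and sin(theta/2) = 0, so both layers coincide, against the trivial
    intersection of their lattices. *)
Lemma twist_sqr_gt0 : 0 < twist_sqr.
Proof.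
have a0 : 0 <= (r - r^-1) ^+ 2 by exact: sqr_ge0.
have b0 : 0 <= 4 * sin (theta / 2) ^+ 2 by apply: mulr_ge0 => //; exact: sqr_ge0.
rewrite lt_neqAle eq_sym [X in _ && X]addr_ge0// andbT.
apply/negP; rewrite /twist_sqr paddr_eq0// => /andP[].
rewrite sqrf_eq0 subr_eq0 => /eqP rE; rewrite mulf_eq0 pnatr_eq0/= sqrf_eq0 => /eqP s0.
have A12 : A1 = A2.
  rewrite layer1E /layer_mx -/r -rE; congr (_ *: (_ *m _)).
  by apply: mx2P; rewrite !rotationE ?cosN ?sinN ?s0 ?oppr0.
have [_] := hinc; rewrite A12 setIid => /seteqP[sub _].
have := sub (A2 *m zvec (1, 0)).
rewrite /= => /(_ _)/(congr1 (mulmx (invmx A2))).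
rewrite mulKmx ?layer_unit// mulmx0 => h.
have : lattice A2 (A2 *m zvec (1, 0)).
  by exists (\col_i if i == 0 then 1 else 0) => //; rewrite zvecE.
move=> /h /colP/(_ 0); rewrite zvec0E mxE => /eqP.
by rewrite oner_eq0.
Qed.

Lemma twist_unit : twist \in unitmx.
Proof.
have : (twist_sqr^-1 *: twist^T) *m twist = 1%:M.
  have d0 : u ^+ 2 + v ^+ 2 != 0 by rewrite uvE gt_eqF// twist_sqr_gt0.
  rewrite -uvE -scalemxAl.
  have tE i j : twist^T i j = twist j i by rewrite mxE.
  have sE (c : R) X i j : (c *: X) i j = c * X i j by rewrite mxE.
  by apply: mx2P; rewrite sE mulmx22E !tE !twistE mxE/=; field; rewrite ?mulr1n.
by move/mulmx1_unit => [].
Qed.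

Lemma moire_mx_unit : moire_mx A q theta \in unitmx.
Proof. by rewrite unitmx_inv invmx_layerB unitmx_mul unitmx_inv hA twist_unit. Qed.

Lemma invmx_moire_mx : invmx (moire_mx A q theta) = invmx A1 - invmx A2.
Proof. exact: invmxK. Qed.

Lemma moire_ratioE : moire_ratio q theta = (Num.sqrt twist_sqr)^-1.
Proof. by rewrite /moire_ratio rV powRN powR12_sqrt// ltW// twist_sqr_gt0. Qed.

Lemma enorm_twist_trmx x : enorm (twist^T *m x) = Num.sqrt twist_sqr * enorm x.
Proof.
rewrite /enorm -sqrtrM ?ltW ?twist_sqr_gt0//; congr Num.sqrt.
rewrite !dotvE !mulmx2E; have tE i j : twist^T i j = twist j i by rewrite mxE.
by rewrite !tE !twistE -uvE; ring.
Qed.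

(** With w = A^(-T) m, G = 2 pi [twist]^T w has norm 2 pi |w| / rho, while m = A^T w has norm at
    most ||A|| |w|. *)
Lemma enorm_zvec_le_freq m : enorm (zvec m) <=
  moire_ratio q theta * spectral_norm A / (2 * pi) *
  enorm (freq (moire_mx A q theta) m).
Proof.
have p0 := pi_gt0 R.
rewrite /freq invmx_moire_mx invmx_layerB trmx_mul -mulmxA.
set w := (invmx A)^T *m zvec m.
have -> : zvec m = A^T *m w by rewrite /w mulmxA -trmx_mul mulVmx// trmx1 mul1mx.
rewrite enormZ enorm_twist_trmx gtr0_norm ?mulr_gt0// moire_ratioE.
have s0 : Num.sqrt twist_sqr != 0 by rewrite gt_eqF// sqrtr_gt0 twist_sqr_gt0.
have pn0 : pi != 0 :> R by rewrite gt_eqF.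
have cancel (a b p e : R) : a != 0 -> p != 0 ->
    a^-1 * b / (2 * p) * (2 * p * (a * e)) = b * e.
  by move=> a0 pi0; field; rewrite a0 pi0.
rewrite cancel//.
exact: enorm_trmx_mulmx_le.
Qed.

Lemma dotv_zvec m n : dotv (zvec m) (zvec n) = (m.1 * n.1 + m.2 * n.2)%:~R :> R.
Proof. by rewrite dotvE !zvec0E !zvec1E intrD !intrM. Qed.

(* Modulo integers the moire phase along layer 1 is driven by
   A_1^T A_2^(-T) and along layer 2 by A_2^T A_1^(-T). *)
Lemma layer_phase j K sigma : diophantine_rotation A q K sigma theta ->
  exists X : 'M[R]_2,
    (forall m, m != 0 ->
       K / enorm (zvec m) `^ (2 * sigma) <= dist_Z2 (X *m zvec m)) /\
    (forall m n, expi (2 * pi *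
         phase (moire_mx A q theta) m (layer_mx A q theta j *m zvec n)) =
       expi (2 * pi * dotv (X *m zvec m) (zvec n))).
Proof.
move=> [_ _ d1 d2].
have bound Q phi m : diophantine_bound A Q phi K sigma -> m != 0 ->
    K / enorm (zvec m) `^ (2 * sigma) <=
    dist_Z2 (Q *: (A^T *m rotation phi *m (invmx A)^T *m zvec m)).
  move=> db m0; rewrite zvecE; apply: db; apply: contraNN m0 => /eqP/colP h.
  have := h 0; have := h 1; rewrite !mxE/= => h1 h0.
  by rewrite [m]surjective_pairing h0 h1.
case: j.
(* On layer 1 the phase is m.n - m.(A_2^(-1) A_1 n), whose first term is an integer. The sign is
   absorbed by using the Diophantine bound at -m. *)
- exists (- (q^-1 *: (A^T *m rotation theta *m (invmx A)^T))); split.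
    move=> m m0; rewrite mulNmx -mulmxN -zvecN -scalemxAl -enorm_zvecN.
    by apply: bound => //; rewrite oppr_eq0.
  move=> m n; rewrite phaseE invmx_moire_mx mulmxA mulmxBl mulVmx ?layer_unit//.
  have XE : q^-1 *: (A^T *m rotation theta *m (invmx A)^T) = (invmx A2 *m A1)^T.
    rewrite invmx_layer2 layer1E -scalemxAl -scalemxAr scalerA rrV.
    rewrite [RHS]linearZ/=; congr (_ *: _).
    rewrite !trmx_mul !rotation_tr !opprK -!mulmxA; congr (_ *m _).
    by rewrite !mulmxA rotationD -splitr.
  rewrite XE mulmxBl mul1mx mulNmx.
  have -> : dotv (zvec m) (zvec n - invmx A2 *m A1 *m zvec n) =
      dotv (- ((invmx A2 *m A1)^T *m zvec m)) (zvec n) + dotv (zvec m) (zvec n).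
    have dB x y z : dotv x (y - z) = dotv x y - dotv x z.
      by rewrite !dotvE !mxE; ring.
    have dN x y : dotv (- x) y = - dotv x y by rewrite !dotvE !mxE; ring.
    by rewrite dB dN dotv_trmx addrC.
  by rewrite dotv_zvec mulrDr expi_2piz.
- exists (q *: (A^T *m rotation (- theta) *m (invmx A)^T)); split.
    by move=> m m0; rewrite -scalemxAl; exact: bound.
  move=> m n; rewrite phaseE invmx_moire_mx mulmxA mulmxBl.
  rewrite [invmx A2 *m _]mulVmx ?layer_unit//.
  have XE : q *: (A^T *m rotation (- theta) *m (invmx A)^T) = (invmx A1 *m A2)^T.
    rewrite invmx_layer1 /layer_mx -/r -scalemxAl -scalemxAr scalerA rr.
    rewrite [RHS]linearZ/=; congr (_ *: _).
    rewrite !trmx_mul !rotation_tr -!mulmxA; congr (_ *m _).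
    by rewrite !mulmxA rotationD -opprD -splitr.
  rewrite XE mulmxBl mul1mx.
  have -> : dotv (zvec m) (invmx A1 *m A2 *m zvec n - zvec n) =
      dotv ((invmx A1 *m A2)^T *m zvec m) (zvec n) + dotv (zvec (- m)) (zvec n).
    have dB x y z : dotv x (y - z) = dotv x y - dotv x z.
      by rewrite !dotvE !mxE; ring.
    have dN x y : dotv (- x) y = - dotv x y by rewrite !dotvE !mxE; ring.
    by rewrite dB zvecN dN dotv_trmx.
  by rewrite dotv_zvec mulrDr expi_2piz.
Qed.

End Layers.

Definition int_box (N : nat) : seq (int * int) :=
  [seq (a, b) | a <- int_segment N, b <- int_segment N].

Lemma mem_int_box N n : (n \in int_box N) = (`|n.1| <= N%:Z) && (`|n.2| <= N%:Z).
Proof.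
have seg (a : int) : (a \in int_segment N) = (`|a| <= N%:Z).
  rewrite -abszE lez_nat; apply/idP/idP; last exact: mem_int_segment.
  apply/allP: a; rewrite all_cat !all_map; apply/andP.
  by split; apply/allP => i; rewrite mem_iota.
apply/allpairsP/idP => [[[a b] /= [+ + ->]]|/andP[h1 h2]]; rewrite ?seg /=.
  by move=> -> ->.
by exists n; rewrite !seg h1 h2 -surjective_pairing.
Qed.

(** A sum over a set counts each point once, so the integer parametrization has to be injective,
    which invertibility gives. *)
Lemma sum_lattice_box A N (V : nmodType) (F : 'cV[R]_2 -> V) : A \in unitmx ->
  \sum_(x \in lattice_box A N) F x = \sum_(n <- int_box N) F (A *m zvec n).
Proof.
move=> uA.
have -> : lattice_box A N = (fun n => A *m zvec n) @` [set` int_box N].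
  apply/seteqP; split=> [_ [n nN <-]|_ [n /= nN <-]].
    exists (n 0 0, n 1 0); last by rewrite map_mx_zvec.
    by rewrite /= mem_int_box/= !nN.
  exists (\col_i if i == 0 then n.1 else n.2); last by rewrite -zvecE.
  by move: nN; rewrite mem_int_box => /andP[h1 h2] i /=; rewrite mxE; case: ifP.
rewrite fsbig_image; last first.
  move=> m n _ _ /(congr1 (mulmx (invmx A))); rewrite !mulKmx// => /colP e.
  have := e 0; have := e 1; rewrite !zvec0E !zvec1E => /intr_inj e1 /intr_inj e0.
  by rewrite [m]surjective_pairing [n]surjective_pairing e0 e1.
rewrite -fsbig_seq//; apply: allpairs_uniq; rewrite ?int_segment_uniq//.
by move=> [a b] [a' b'] _ _ [-> ->].
Qed.

Lemma sum_int_box_expi N (y : 'cV[R]_2) :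
  \sum_(n <- int_box N) expi (2 * pi * dotv y (zvec n)) =
  dirichlet N (y 0 0) * dirichlet N (y 1 0).
Proof.
rewrite big_allpairs/= /dirichlet mulr_suml; apply: eq_bigr => a _.
rewrite mulr_sumr; apply: eq_bigr => b _.
by rewrite -expiD dotvE zvec0E zvec1E mulrDr.
Qed.

End MoireLattice.

(** * The averaged estimate *)

Section Equidistribution.
Context {R : realType}.
Implicit Types (Z : nat -> R[i]) (z : R[i]).

Lemma cvg_sum_seq (T : Type) (s : seq T) (F : T -> nat -> R) (l : T -> R) :
  (forall i, F i k @[k --> \oo] --> l i) ->
  \sum_(i <- s) F i k @[k --> \oo] --> \sum_(i <- s) l i.
Proof.
move=> Fl; elim: s => [|i s IH].
  by under eq_fun do rewrite big_nil; rewrite big_nil; exact: cvg_cst.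
under eq_fun do rewrite big_cons; rewrite big_cons.
by apply: cvgD; [exact: Fl|exact: IH].
Qed.

Lemma cmod_lim_le Z z (b : R) :
  complex.Re (Z k) @[k --> \oo] --> complex.Re z ->
  complex.Im (Z k) @[k --> \oo] --> complex.Im z ->
  (\forall k \near \oo, cmod (Z k) <= b) -> cmod z <= b.
Proof.
move=> hr hi hb.
have hs : complex.Re (Z k) ^+ 2 + complex.Im (Z k) ^+ 2 @[k --> \oo] -->
    complex.Re z ^+ 2 + complex.Im z ^+ 2.
  by rewrite !expr2; apply: cvgD; apply: cvgM.
have hm : cmod (Z k) @[k --> \oo] --> cmod z.
  rewrite cmodE; under eq_fun do rewrite cmodE.
  by apply: (continuous_cvg _ _ hs); exact: sqrt_continuous.
have -> : cmod z = limn (fun k => cmod (Z k)) by exact/esym/cvg_lim.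
by apply: limr_le => //; exact: cvgP hm.
Qed.

Lemma size_int_box N : size (int_box N) = ((2 * N + 1) ^ 2)%N.
Proof. by rewrite size_allpairs size_int_segment mulnn. Qed.

Lemma cell_mod_periodic (M : 'M[R]_2) (T : Type) (g : 'cV[R]_2 -> T) x :
  M \in unitmx -> (forall x y, lattice M y -> g (x + y) = g x) ->
  g (cell_mod M x) = g x.
Proof.
move=> uM pg.
have [_ My] : [set y | unit_cell M y /\ lattice M (x - y)] (cell_mod M x).
  by apply: xgetPex; have [y yc yM] := cell_repr uM x; exists y.
by rewrite -(pg _ _ My) addrC subrK.
Qed.

Section Estimate.
Variables (A : 'M[R]_2) (q theta K sigma s : R) (j : layer).
Variable f : 'cV[R]_2 -> R[i].
Hypotheses (hA : A \in unitmx) (hq : 0 < q).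
Hypothesis hinc : incommensurate A q theta.
Hypotheses (hsigma : 0 < sigma) (hs : 1 < s) (hK : 0 < K).
Hypothesis hdioph : diophantine_rotation A q K sigma theta.
Local Notation M := (moire_mx A q theta).
Hypothesis hf : cintegrable (unit_cell M) f.
Hypothesis hfb : has_ubound (fourier_weights M (2 * (sigma + s)) f).

Let al : R := 2 * (sigma + s).
Let S : R := sup (fourier_weights M al f).
Let kap : R := moire_ratio q theta * spectral_norm A / (2 * pi).

Let uM : M \in unitmx. Proof. exact: moire_mx_unit. Qed.
Let al0 : 0 <= al.
Proof.
by rewrite /al mulr_ge0// addr_ge0 ?(ltW hsigma)// (le_trans ler01 (ltW hs)).
Qed.

Let weight_le m : enorm (freq M m) `^ al * cmod (fcoef M f m) <= S.
Proof.
apply: ub_le_sup hfb _ _; exists (freq M m) => //.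
by apply/dual_latticeP; exists m.
Qed.

Let S0 : 0 <= S.
Proof.
by apply: le_trans (weight_le 0); rewrite mulr_ge0 ?powR_ge0 ?cmod_ge0.
Qed.

Let ss1 : 1 < sigma + s. Proof. by rewrite (lt_trans hs)// ltrDr. Qed.

Let kap0 : 0 <= kap.
Proof.
rewrite /kap !mulr_ge0 ?invr_ge0 ?mulr_ge0 ?pi_ge0 ?spectral_norm_ge0//.
exact: powR_ge0.
Qed.

Let fcoef_le m : m != 0 ->
  cmod (fcoef M f m) <= kap `^ al * S * enorm (zvec m) `^ (- al).
Proof.
move=> m0; have z1 : 0 < enorm (zvec m : 'cV[R]_2).
  exact: lt_le_trans ltr01 (enorm_zvec_ge1 m0).
rewrite powRN ler_pdivlMr ?powR_gt0//.
have h : enorm (zvec m) `^ al <= kap `^ al * enorm (freq M m) `^ al.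
  rewrite -powRM ?enorm_ge0//.
  rewrite ge0_ler_powR ?nnegrE ?(mulr_ge0 kap0) ?enorm_ge0//.
  exact: (enorm_zvec_le_freq hA hq hinc m).
apply: le_trans (ler_wpM2l (cmod_ge0 _) h) _.
rewrite mulrCA ler_wpM2l ?powR_ge0// mulrC; exact: weight_le.
Qed.

(** At m = 0 both |G|^(2(sigma+s)) and the lattice weight are 0, so the decay does not control the
    mean; it is added separately. *)
Let B m : R := kap `^ al * S * lattice_weight (sigma + s) m +
  (m == 0)%:R * cmod (fcoef M f 0).

Let sB : summable2 B.
Proof.
have C0 : 0 <= kap `^ al * S by rewrite mulr_ge0 ?powR_ge0.
split.
  by move=> m; rewrite addr_ge0// mulr_ge0 ?lattice_weight_ge0 ?cmod_ge0.
exists (kap `^ al * S * (4 * (zeta (2 * (sigma + s)) +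
     2 `^ (- (sigma + s)) * zeta (sigma + s) ^+ 2)) +
   cmod (fcoef M f 0)) => l ul.
rewrite big_split/= -mulr_sumr lerD//.
  by rewrite ler_wpM2l// sum_lattice_weight_le.
rewrite -mulr_suml ler_piMl ?cmod_ge0// -natr_sum -[1]/(1%:R) ler_nat.
have -> : (\sum_(m <- l) (m == 0%R : nat) = count_mem 0%R l)%N.
  by elim: l {ul} => [|m l IH]; rewrite ?big_nil ?big_cons ?IH.
by rewrite count_uniq_mem// leq_b1.
Qed.

Let cB m : cmod (fcoef M f m) <= B m.
Proof.
rewrite /B; have [->|m0] := eqVneq m 0.
  by rewrite mul1r lerDr !mulr_ge0 ?powR_ge0.
by rewrite mul0r addr0 lattice_weightE; exact: fcoef_le.
Qed.

Lemma representative_exists : exists g, continuous_representative M f g.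
Proof. by exists (fseries M f); exact: fseries_representative sB cB. Qed.

Variable N : nat.
Let L : R := (2 * N + 1)%:R.
Let L0 : 0 < L. Proof. by rewrite ltr0n addn1. Qed.

Let layer_point n : 'cV[R]_2 := layer_mx A q theta j *m zvec n.

Let layer_sum m : R[i] :=
  \sum_(n <- int_box N) expi (2 * pi * phase M m (layer_point n)).

Let layer_sum0 : layer_sum 0 = real_complex R (L ^+ 2).
Proof.
rewrite /layer_sum (eq_bigr (fun=> 1)); last first.
  by move=> n _; rewrite /phase !mul0r addr0 mulr0 expi0.
rewrite big_const_seq count_predT size_int_box iter_addr_0.
by rewrite -[LHS]/(((2 * N + 1) ^ 2)%:R) natrX rmorphXn/= rmorph_nat.
Qed.

Let layer_sum_le m : m != 0 ->
  cmod (layer_sum m) <= L * (Num.sqrt 2 / (2 * K) * enorm (zvec m) `^ (2 * sigma)).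
Proof.
move=> m0; have [X [Xd Xp]] := layer_phase hA hq j hdioph.
have z1 : 0 < enorm (zvec m : 'cV[R]_2).
  exact: lt_le_trans ltr01 (enorm_zvec_ge1 m0).
have zp : 0 < enorm (zvec m) `^ (2 * sigma) by rewrite powR_gt0.
rewrite /layer_sum; under eq_bigr do rewrite Xp.
rewrite sum_int_box_expi.
apply: le_trans (dirichlet2_le N _ (Xd m m0)) _; first by rewrite divr_gt0.
rewrite ler_wpM2l ?(ltW L0)// le_eqVlt; apply/orP; left; apply/eqP.
move: (_ `^ _) (Num.sqrt _) zp => e r2 e0.
by field; rewrite !gt_eqF.
Qed.

Let partial_average k : R[i] := real_complex R (L ^+ 2)^-1 *
  (\sum_(n <- int_box N) fpartial M f k (layer_point n)) - fcoef M f 0.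

(** The zero frequency contributes L^2 times the mean of f, which the normalization and the
    subtraction remove exactly. *)
Let partial_averageE k : 0 \in int2_enum k -> partial_average k =
  real_complex R (L ^+ 2)^-1 *
  \sum_(m <- int2_enum k | m != 0) fcoef M f m * layer_sum m.
Proof.
move=> k0; rewrite /partial_average /fpartial exchange_big/=.
under eq_bigr do rewrite -mulr_sumr.
have ls0 := layer_sum0; rewrite /layer_sum in ls0.
rewrite (bigD1_seq 0) ?int2_enum_uniq//= ls0.
have cancel (a b c d : R[i]) : a * b = 1 -> a * (c * b + d) - c = a * d.
  by move=> ab; rewrite mulrDr mulrCA ab mulr1 addrAC subrr add0r.
by rewrite cancel// -rmorphM/= mulVf ?gt_eqF ?exprn_gt0.
Qed.

Let bound : R := 2 * Num.sqrt 2 / K * kap `^ al *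
  (zeta (2 * s) + 2 `^ (- s) * zeta s ^+ 2) * S * L^-1.

Let partial_average_le k : 0 \in int2_enum k -> cmod (partial_average k) <= bound.
Proof.
move=> k0; rewrite partial_averageE// cmodM cmod_real ger0_norm; last first.
  by rewrite invr_ge0 exprn_ge0// ltW.
rewrite mulrC ler_pdivrMr ?exprn_gt0//.
(* The coefficient constant times the kernel constant. *)
pose C := kap `^ al * S * (L * (Num.sqrt 2 / (2 * K))).
have C0 : 0 <= C.
  rewrite /C mulr_ge0 ?(mulr_ge0 (powR_ge0 _ _) S0)// mulr_ge0 ?(ltW L0)//.
  by rewrite divr_ge0 ?sqrtr_ge0// mulr_ge0// ltW.
apply: (@le_trans _ _ (C * \sum_(m <- int2_enum k) lattice_weight s m)).
  apply: le_trans (cmod_sum _ _ _) _.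
  rewrite mulr_sumr [leRHS](bigID (fun m => m != 0))/=.
  apply: (@le_trans _ _ (\sum_(m <- int2_enum k | m != 0) C * lattice_weight s m)).
    apply: ler_sum => m m0; rewrite cmodM.
    apply: le_trans (ler_pM (cmod_ge0 _) (cmod_ge0 _) (fcoef_le m0) (layer_sum_le m0)) _.
    have z1 : enorm (zvec m : 'cV[R]_2) != 0.
      by rewrite gt_eqF// (lt_le_trans ltr01 (enorm_zvec_ge1 m0)).
    (* The small divisor |m|^(2 sigma) eats part of the decay |m|^(-2(sigma+s)) and leaves
       |m|^(-2s). *)
    rewrite lattice_weightE (_ : - (2 * s) = - al + 2 * sigma); last by rewrite /al; ring.
    rewrite powRD; last by rewrite z1 implybT.
    by rewrite le_eqVlt /C; apply/orP; left; apply/eqP; ring.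
  by rewrite lerDl sumr_ge0// => m _; rewrite mulr_ge0 ?lattice_weight_ge0.
apply: le_trans (ler_wpM2l C0 (sum_lattice_weight_le hs (int2_enum_uniq k))) _.
rewrite /C /bound le_eqVlt; apply/orP; left; apply/eqP.
by field; rewrite !gt_eqF.
Qed.

(** N is fixed and the partial sums converge at each of the finitely many box points, so the bound
    uniform in k passes to the limit. *)
Lemma average_le g : continuous_representative M f g ->
  cmod (((2 * N + 1)%:R ^+ 2)^-1 *
    (\sum_(x \in lattice_box (layer_mx A q theta j) N) g (cell_mod M x)) -
    cmean (unit_cell M) f) <= bound.
Proof.
move=> rg; have [_ _ pg _] := rg.
have gE := representative_unique uM hf sB cB rg.
rewrite sum_lattice_box ?layer_unit//.
under eq_bigr do rewrite (cell_mod_periodic _ uM pg) gE.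
rewrite -fcoef0.
have -> : ((2 * N + 1)%:R ^+ 2)^-1 = real_complex R (L ^+ 2)^-1.
  by rewrite fmorphV rmorphXn/= rmorph_nat.
apply: (@cmod_lim_le partial_average).
- rewrite ReD Re_realM Re_sum.
  under eq_fun do rewrite /partial_average ReD Re_realM Re_sum.
  apply: cvgD; last exact: cvg_cst.
  apply: cvgM; first exact: cvg_cst.
  by apply: cvg_sum_seq => n; exact: (Re_fpartial_cvg sB cB).
- rewrite ImD Im_realM Im_sum.
  under eq_fun do rewrite /partial_average ImD Im_realM Im_sum.
  apply: cvgD; last exact: cvg_cst.
  apply: cvgM; first exact: cvg_cst.
  by apply: cvg_sum_seq => n; exact: (Im_fpartial_cvg sB cB).
- near=> k; apply: partial_average_le; rewrite mem_int2_enum.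
  by near: k; exact: nbhs_infty_gt.
Unshelve. all: by end_near. Qed.

End Estimate.

End Equidistribution.

Theorem proposition3p5 (R : realType) (A : 'M[R]_2) (q theta K sigma s : R)
    (j : layer) (f : 'cV[R]_2 -> R[i])
    (hA : A \in unitmx) (hq : 0 < q)
    (hinc : incommensurate A q theta)
    (hsigma : 1433%:R / 1248%:R < sigma) (hs : 1 < s)
    (hK : 0 < K) (hdioph : diophantine_rotation A q K sigma theta)
    (hf : cintegrable (unit_cell (moire_mx A q theta)) f)
    (hfbound : has_ubound
       (fourier_weights (moire_mx A q theta) (2 * (sigma + s)) f)) :
  let M := moire_mx A q theta in
  (exists g, continuous_representative M f g) /\
  (forall g, continuous_representative M f g ->
    \forall N \near \oo,
      complex.Re `| ((2 * N + 1)%:R ^+ 2)^-1 *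
          (\sum_(x \in lattice_box (layer_mx A q theta j) N) g (cell_mod M x))
        - cmean (unit_cell M) f |
      <= 2 * Num.sqrt 2 / K
         * (moire_ratio q theta * spectral_norm A / (2 * pi))
             `^ (2 * (sigma + s))
         * (zeta (2 * s) + 2 `^ (- s) * zeta s ^+ 2)
         * sup (fourier_weights M (2 * (sigma + s)) f)
         * (2 * N + 1)%:R^-1).
Proof.
have sigma0 : 0 < sigma.
  apply: le_lt_trans hsigma.
  by apply: divr_ge0; exact: ler0n.

move=> M; split; first exact: (representative_exists hA hq hinc sigma0 hs hf hfbound).
move=> g rg; apply: nearW => N.
exact: (average_le j hA hq hinc sigma0 hs hK hdioph hf hfbound N rg).
Qed.
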